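(* Let $\alpha_1,\alpha_2,\alpha_3,\alpha_4$ be odd integers greater than $1$ and set $$n_1=(\alpha_2-1)(\alpha_3-1)\alpha_4+\alpha_2,\quad n_2=(\alpha_3-1)(\alpha_4-1)\alpha_1+\alpha_3,$$ $$n_3=(\alpha_4-1)(\alpha_1-1)\alpha_2+\alpha_4,\quad n_4=(\alpha_1-1)(\alpha_2-1)\alpha_3+\alpha_1.$$ If $\gcd(n_1,n_2,n_3,n_4)=1$, then $S=\langle n_1,n_2,n_3,n_4\rangle$ is a numerical semigroup of embedding dimension four, generated by odd integers, which is almost symmetric of type three. Moreover, every almost symmetric numerical semigroup of embedding dimension four and type three whose minimal generators are all odd arises in this way (for suitable odd $\alpha_i>1$).
   Context: $\mathrm{PF}(S)$ is the set of integers $f\notin S$ with $f+s\in S$ for all $s\in S\setminus\{0\}$; the type of $S$ is $|\mathrm{PF}(S)|$; $S$ is almost symmetric if $2|\mathbb{N}\setminus S|=F(S)+|\mathrm{PF}(S)|$, where $F(S)=\max(\mathbb{Z}\setminus S)$. The embedding dimension is the number of minimal generators. *)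

(* Defs.v *)
From mathcomp Require Import all_boot.
Set Implicit Arguments. Unset Strict Implicit. Unset Printing Implicit Defensive.

Fixpoint in_gen (gens : seq nat) (x : nat) : bool :=
  match gens with
  | [::] => x == 0
  | g :: gs => [exists k : 'I_x.+1, (k * g <= x) && in_gen gs (x - k * g)]
  end.

Definition numerical_semigroup (S : pred nat) : Prop :=
  S 0 /\ (forall x y, S x -> S y -> S (x + y)) /\
  exists N, forall x, N <= x -> S x.

Definition min_gen (S : pred nat) (x : nat) : Prop :=
  0 < x /\ S x /\ ~ (exists a b, 0 < a /\ 0 < b /\ S a /\ S b /\ a + b = x).

Definition card_is (P : nat -> Prop) (c : nat) : Prop :=
  exists l : seq nat, uniq l /\ (forall x, x \in l <-> P x) /\ size l = c.

Definition embdim (S : pred nat) (e : nat) : Prop := card_is (min_gen S) e.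

(* Frobenius number F(S) (for S <> N, where it is a nonnegative integer). *)
Definition frobenius (S : pred nat) (f : nat) : Prop :=
  ~~ S f /\ forall x, f < x -> S x.

(* Pseudo-Frobenius numbers (for S <> N they are all nonnegative). *)
Definition pseudo_frob (S : pred nat) (f : nat) : Prop :=
  ~~ S f /\ forall s, S s -> 0 < s -> S (f + s).

Definition genus (S : pred nat) (g : nat) : Prop := card_is (fun x => ~~ S x) g.

Definition sg_type (S : pred nat) (t : nat) : Prop := card_is (pseudo_frob S) t.

Definition almost_symmetric (S : pred nat) : Prop :=
  exists g f t, genus S g /\ frobenius S f /\ sg_type S t /\ 2 * g = f + t.

Definition gens4 (a1 a2 a3 a4 : nat) : seq nat :=
  [:: (a2 - 1) * (a3 - 1) * a4 + a2;
      (a3 - 1) * (a4 - 1) * a1 + a3;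
      (a4 - 1) * (a1 - 1) * a2 + a4;
      (a1 - 1) * (a2 - 1) * a3 + a1].

Definition gcd_seq (s : seq nat) : nat := foldr gcdn 0 s.

(* Main.v *)
Require Import Defs.
From mathcomp Require Import all_boot.
From mathcomp Require Import zify.
Set Implicit Arguments. Unset Strict Implicit. Unset Printing Implicit Defensive.

(** Put [b_i = a_i - 1] and [f = b_1 b_2 b_3 b_4 - 1]. The generators satisfy [f + n_1 = b_2 n_2],
    [f + n_2 = b_3 n_3], [f + n_3 = b_4 n_4], [f + n_4 = b_1 n_1]. These relations reduce every element of [S]
    modulo [n_1] to one of [n_1] explicit combinations of [n_2], [n_3], [n_4], which therefore form the Apery set
    of [n_1]; it shows that the pseudo-Frobenius numbers are [f], [2f], [3f] and that [x] and [3f - x] are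
    both gaps only for [x = f] and [x = 2f].

    Conversely let [f], [g], [F] be the pseudo-Frobenius numbers. Almost symmetry says that [x] or [F - x] is in
    [S] unless [x] is [f] or [g]; hence [F = f + g], [F] is odd, and we take [f] odd and [g] even. Draw an arc
    [i -> j] if [f + n_i - n_j] is in [S]. By duality the arcs for [g] are the reversed non-arcs. When all
    generators are odd, two combinations of the generators with equal value and congruent coefficients modulo 2
    can be averaged; whenever the average has nonnegative coefficients this puts an element in [S], and a finite
    case analysis on the digraph and on the parities of factorizations leaves only the directed four-cycle. There
    [g = 2f], and comparing the box of combinations above with the residues modulo [n_1] gives the formulas for
    the generators. *)

(** * Membership in a finitely generated monoid *)

Lemma in_gen_cons (g : nat) (gs : seq nat) (x : nat) :
  in_gen (g :: gs) x <-> exists k y, in_gen gs y /\ x = k * g + y.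
Proof.
split=> [/existsP[k /andP[le_kg gx]]|[k [y [gy ->]]]].
  by exists k, (x - k * g); rewrite subnKC.
(* [in_gen] tries coefficients up to [x] only; for [g = 0] the given [k] may exceed this bound, so
   the coefficient 0 is taken instead. *)
have [g0|g_gt0] := posnP g.
  by apply/existsP; exists ord0; rewrite /= mul0n subn0 g0 muln0 add0n.
have lt_k : k < (k * g + y).+1 by rewrite ltnS; nia.
by apply/existsP; exists (Ordinal lt_k); rewrite /= leq_addr addKn.
Qed.

Lemma in_gen4P (g1 g2 g3 g4 x : nat) :
  in_gen [:: g1; g2; g3; g4] x <->
  exists c1 c2 c3 c4, x = c1 * g1 + c2 * g2 + c3 * g3 + c4 * g4.
Proof.
split.
  case/in_gen_cons=> c1 [? [/in_gen_cons[c2 [? [/in_gen_cons[c3 [? [H ->]]] ->]]] ->]].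
  case/in_gen_cons: H => c4 [? [/eqP-> ->]].
  by exists c1, c2, c3, c4; lia.
case=> [c1 [c2 [c3 [c4 ->]]]].
apply/in_gen_cons; exists c1, (c2 * g2 + c3 * g3 + c4 * g4); split; last by lia.
apply/in_gen_cons; exists c2, (c3 * g3 + c4 * g4); split; last by lia.
apply/in_gen_cons; exists c3, (c4 * g4); split; last by lia.
by apply/in_gen_cons; exists c4, 0; split; last by lia.
Qed.

Lemma card_is_inj (P : nat -> Prop) (c d : nat) : card_is P c -> card_is P d -> c = d.
Proof.
move=> [s [us [sP <-]]] [t [ut [tP <-]]].
by apply/perm_size/uniq_perm => // x; apply/idP/idP => [/sP/tP|/tP/sP].
Qed.

(** * Gaps, genus and reflection in the Frobenius number *)

Section Gaps.
Variables (S : pred nat) (F : nat).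
Hypothesis (S_add : forall x y, S x -> S y -> S (x + y)) (frobF : frobenius S F).

(** Through [double_gap_count], almost symmetry says that the twin gaps number one less than the
    type. *)
Definition twin_gap (x : nat) : bool := ~~ S x && ~~ S (F - x).

Lemma gap_le x : ~~ S x -> x <= F.
Proof. by move=> Sx; rewrite leqNgt; apply: contra Sx => /(proj2 frobF). Qed.

Lemma genus_count : genus S (count (predC S) (iota 0 F.+1)).
Proof.
exists (filter (predC S) (iota 0 F.+1)); rewrite filter_uniq ?iota_uniq ?size_filter //.
split=> //; split=> // x; rewrite mem_filter mem_iota /= add0n ltnS.
by split=> [/andP[]|Sx] //; rewrite Sx gap_le.
Qed.

(* [x |-> F - x] maps the elements of [S] below [F] injectively into the gaps; what it misses are the twin gaps. *)
Lemma double_gap_count :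
  2 * count (predC S) (iota 0 F.+1) = F.+1 + count twin_gap (iota 0 F.+1).
Proof.
have refl : count (fun x => S (F - x)) (iota 0 F.+1) = count S (iota 0 F.+1).
  have -> : count (fun x => S (F - x)) (iota 0 F.+1) =
            count S [seq F - x | x <- iota 0 F.+1] by rewrite count_map.
  apply/permP/uniq_perm; rewrite ?iota_uniq ?map_inj_in_uniq ?iota_uniq //.
    by move=> x y; rewrite !mem_iota; lia.
  move=> x; rewrite mem_iota; apply/mapP/idP => [[y] | lt_x].
    by rewrite mem_iota; lia.
  by exists (F - x); rewrite ?mem_iota; lia.
have split_gaps : count (predC S) (iota 0 F.+1) =
    count (fun x => S (F - x)) (iota 0 F.+1) + count twin_gap (iota 0 F.+1).
  rewrite -count_predUI [X in _ + X](_ : _ = 0) ?addn0; last first.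
    by apply/eqP; rewrite -leqn0 leqNgt -has_count -all_predC; apply/allP=> x _ /=;
       rewrite /twin_gap; case: (S (F - x)); rewrite ?andbF.
  apply: eq_in_count => x; rewrite mem_iota /= add0n ltnS /twin_gap => le_x.
  case Sx: (S x) => /=; last by case: (S _).
  rewrite orbF; apply/esym/negbTE; apply: contra (proj1 frobF) => SFx.
  by rewrite -(subnKC le_x) S_add.
have := count_predC S (iota 0 F.+1); rewrite size_iota; lia.
Qed.

End Gaps.

(** * The cyclic relations and their Apery set *)

Lemma eq_mod_lt d v w : v %% d = w %% d -> v < w -> exists m, w = v + m.+1 * d.
Proof.
move=> E lt; have Dv := divn_eq v d; have Dw := divn_eq w d.
have lt_div : v %/ d < w %/ d by nia.
by exists (w %/ d - v %/ d).-1; rewrite prednK ?subn_gt0 // mulnBl; nia.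
Qed.

Section Cycle.
Variables (n1 n2 n3 n4 f b1 b2 b3 b4 : nat) (S : pred nat).
Hypothesis SP : forall x, S x <->
  exists c1 c2 c3 c4, x = c1 * n1 + c2 * n2 + c3 * n3 + c4 * n4.

Lemma S_add x y : S x -> S y -> S (x + y).
Proof.
case/SP=> a1 [a2 [a3 [a4 ->]]] /SP[c1 [c2 [c3 [c4 ->]]]]; apply/SP.
by exists (a1 + c1), (a2 + c2), (a3 + c3), (a4 + c4); lia.
Qed.

Lemma S_mul1 m : S (m * n1).
Proof. by apply/SP; exists m, 0, 0, 0; lia. Qed.

Hypotheses (b1_gt1 : 1 < b1) (b2_gt1 : 1 < b2) (b3_gt1 : 1 < b3) (b4_gt1 : 1 < b4).
Hypotheses (e1 : f + n1 = b2 * n2) (e2 : f + n2 = b3 * n3).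
Hypotheses (e3 : f + n3 = b4 * n4) (e4 : f + n4 = b1 * n1).
Hypothesis n1_gt0 : 0 < n1.

(** Three pieces: cells, a wall and a top. Their largest elements are [3f + n1], [2f + n1] and
    [f + n1], which is where the pseudo-Frobenius numbers come from. *)
Definition box : seq nat :=
  [seq i * n2 + w | i <- iota 0 b2,
                    w <- [seq j * n3 + k * n4 | j <- iota 0 b3, k <- iota 0 b4.+1]]
  ++ [seq i * n2 + b3 * n3 | i <- iota 0 b2] ++ [:: b2 * n2].

Lemma size_box : size box = b2 * b3 * b4.+1 + b2.+1.
Proof. by rewrite !size_cat !size_map !size_allpairs !size_iota addn1 mulnA. Qed.

Lemma boxP v : v \in box <->
  [\/ exists i j k, [/\ i < b2, j < b3, k <= b4 & v = i * n2 + j * n3 + k * n4],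
      exists2 i, i < b2 & v = i * n2 + b3 * n3 | v = b2 * n2].
Proof.
rewrite !mem_cat; split.
  case/or3P=> [/allpairsP[[i w] [lti /allpairsP[[j k] [ltj ltk /= Ew]] Ev]] | /mapP[i] | ].
  - move: lti ltj ltk; rewrite !mem_iota /= => *; apply: Or31.
    by exists i, j, k; split; rewrite ?Ev /= ?Ew; lia.
  - by rewrite mem_iota => *; apply: Or32; exists i.
  - by rewrite inE => /eqP->; apply: Or33.
case=> [[i [j [k [lti ltj lek ->]]]] | [i lti ->] | ->]; apply/or3P.
- apply/Or31/allpairsP; exists (i, j * n3 + k * n4); rewrite mem_iota addnA; split=> //.
  by apply/allpairsP; exists (j, k); rewrite !mem_iota /=; split=> //; lia.
- by apply/Or32/mapP; exists i; rewrite ?mem_iota.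
- by apply/Or33; rewrite inE.
Qed.

Lemma box_cell i j k : i < b2 -> j < b3 -> k <= b4 -> i * n2 + j * n3 + k * n4 \in box.
Proof. by move=> *; apply/boxP; apply: Or31; exists i, j, k. Qed.

Lemma box_wall i : i < b2 -> i * n2 + b3 * n3 \in box.
Proof. by move=> *; apply/boxP; apply: Or32; exists i. Qed.

Lemma box_top : b2 * n2 \in box.
Proof. by apply/boxP; apply: Or33. Qed.

Definition covered (x : nat) : Prop := exists2 v, v \in box & exists m, x = v + m * n1.

Lemma covered_le x y : covered x -> (exists m, y = x + m * n1) -> covered y.
Proof. by move=> [v vb [m ->]] [k ->]; exists v => //; exists (m + k); lia. Qed.

Lemma covered_by v m x : v \in box -> x = v + m * n1 -> covered x.
Proof. by exists v => //; exists m. Qed.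

(** The first and last relations give [b2 * n2 + n4 = f + n1 + n4 = (b1 + 1) * n1]. *)
Lemma covered_top k : k <= b4 -> covered (b2 * n2 + k * n4).
Proof.
case: k => [|k] lek; first by apply: (covered_by (m := 0) box_top); lia.
by apply: (covered_by (m := b1.+1) (@box_cell 0 0 k _ _ _)); lia.
Qed.

(** An overflowing coefficient is rewritten by its relation; the summand [f] that appears is
    absorbed by another generator through a second relation, or the sum already lies on the wall or
    the top. The same scheme serves [n3] and [n4]. *)
Lemma covered_n2 v : v \in box -> covered (v + n2).
Proof.
case/boxP=> [[i [j [k [lti ltj lek ->]]]] | [i lti ->] | ->].
- have [lti1|] := ltnP i.+1 b2.
    by apply: (covered_by (m := 0) (@box_cell i.+1 j k _ _ _)); lia.
  move=> lei; have Ei : b2 = i.+1 by lia.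
  have E1 : f + n1 = i * n2 + n2 by rewrite e1 Ei; lia.
  case: j ltj => [|j] ltj.
    by have := covered_top lek; rewrite -e1 E1; congr covered; lia.
  case: k lek => [|k] lek.
    by apply: (covered_by (m := 1) (@box_cell 0 j b4 _ _ _)); lia.
  by apply: (covered_by (m := b1.+1) (@box_cell 0 j.+1 k _ _ _)); lia.
- have [lti1|] := ltnP i.+1 b2.
    by apply: (covered_by (m := 0) (@box_wall i.+1 _)); lia.
  move=> lei; have Ei : b2 = i.+1 by lia.
  have E1 : f + n1 = i * n2 + n2 by rewrite e1 Ei; lia.
  have [j Ej] : exists j, b3 = j.+1 by exists b3.-1; lia.
  have E2 : f + n2 = j * n3 + n3 by rewrite e2 Ej; lia.
  by apply: (covered_by (m := 1) (@box_cell 0 j b4 _ _ _)); lia.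
- by apply: (covered_by (m := 1) (@box_wall 0 _)); lia.
Qed.

Lemma covered_n3 v : v \in box -> covered (v + n3).
Proof.
case/boxP=> [[i [j [k [lti ltj lek ->]]]] | [i lti ->] | ->].
- have [ltj1|] := ltnP j.+1 b3.
    by apply: (covered_by (m := 0) (@box_cell i j.+1 k _ _ _)); lia.
  move=> lej; have Ej : b3 = j.+1 by lia.
  have E2 : f + n2 = j * n3 + n3 by rewrite e2 Ej; lia.
  case: k lek => [|k] lek.
    by apply: (covered_by (m := 0) (@box_wall i _)); lia.
  have [lti1|] := ltnP i.+1 b2.
    by apply: (covered_by (m := b1) (@box_cell i.+1 0 k _ _ _)); lia.
  move=> lei; have Ei : b2 = i.+1 by lia.
  have E1 : f + n1 = i * n2 + n2 by rewrite e1 Ei; lia.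
  apply: covered_le (@covered_top k _) _; first by lia.
  by exists b1; lia.
- have [lti1|] := ltnP i.+1 b2.
    by apply: (covered_by (m := 0) (@box_cell i.+1 0 b4 _ _ _)); lia.
  move=> lei; have Ei : b2 = i.+1 by lia.
  have E1 : f + n1 = i * n2 + n2 by rewrite e1 Ei; lia.
  apply: covered_le (@covered_top b4 _) _; first by lia.
  by exists 0; lia.
- by apply: (covered_by (m := 1) (@box_cell 0 0 b4 _ _ _)); lia.
Qed.

Lemma covered_n4 v : v \in box -> covered (v + n4).
Proof.
case/boxP=> [[i [j [k [lti ltj lek ->]]]] | [i lti ->] | ->].
- have [ltk|gek] := ltnP k b4.
    by apply: (covered_by (m := 0) (@box_cell i j k.+1 _ _ _)); lia.
  have -> : k = b4 by lia.
  have [ltj1|] := ltnP j.+1 b3.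
    by apply: (covered_by (m := b1) (@box_cell i j.+1 0 _ _ _)); lia.
  move=> lej; have Ej : b3 = j.+1 by lia.
  have E2 : f + n2 = j * n3 + n3 by rewrite e2 Ej; lia.
  by apply: (covered_by (m := b1) (@box_wall i _)); lia.
- have [lti1|] := ltnP i.+1 b2.
    by apply: (covered_by (m := b1) (@box_cell i.+1 0 0 _ _ _)); lia.
  move=> lei; have Ei : b2 = i.+1 by lia.
  have E1 : f + n1 = i * n2 + n2 by rewrite e1 Ei; lia.
  by apply: (covered_by (m := b1) box_top); lia.
- by have := @covered_top 1; rewrite mul1n; apply; lia.
Qed.

Lemma S_covered x : S x -> covered x.
Proof.
case/SP=> c1 [c2 [c3 [c4 ->]]].
have step (c g : nat) (Hg : forall v, v \in box -> covered (v + g)) y :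
    covered y -> covered (y + c * g).
  move=> Hy; elim: c => [|c [v vb [m Em]]]; first by rewrite addn0.
  have [w wb [k Ek]] := Hg v vb.
  by exists w => //; exists (k + m); lia.
have cov1 : covered (c1 * n1).
  by apply: (covered_by (m := c1) (@box_cell 0 0 0 _ _ _)); lia.
exact: step covered_n4 _ (step _ _ covered_n3 _ (step _ _ covered_n2 _ cov1)).
Qed.

Lemma box_S v : v \in box -> S v.
Proof.
case/boxP=> [[i [j [k [_ _ _ ->]]]] | [i _ ->] | ->]; apply/SP.
- by exists 0, i, j, k; lia.
- by exists 0, i, b3, 0; lia.
- by exists 0, b2, 0, 0; lia.
Qed.

Hypothesis S_cofinite : exists N, forall x, N <= x -> S x.

(** Cofiniteness puts an element of [S] into every class modulo [n1], and that element is covered by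
    a box element of its class. *)
Lemma box_residues : {subset iota 0 n1 <= [seq v %% n1 | v <- box]}.
Proof.
move=> r; rewrite mem_iota /= => ltr; have [N HN] := S_cofinite.
have [|v vb [m Ev]] := @S_covered (r + N * n1); first by apply: HN; nia.
apply/mapP; exists v => //.
by have := modnMDl N r n1; rewrite addnC Ev addnC modnMDl (modn_small ltr) => ->.
Qed.

Lemma n1_le_size_box : n1 <= size box.
Proof.
by have := uniq_leq_size (iota_uniq 0 n1) box_residues; rewrite size_iota size_map.
Qed.

Lemma f2_eq : f + f + n1 = b2.-1 * n2 + b3 * n3.
Proof.
have [i Ei] : exists i, b2 = i.+1 by exists b2.-1; lia.
by move: e1; rewrite Ei /=; lia.
Qed.

Lemma f3_eq : f + f + f + n1 = b2.-1 * n2 + b3.-1 * n3 + b4 * n4.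
Proof.
have [i Ei] : exists i, b3 = i.+1 by exists b3.-1; lia.
by move: e2 f2_eq; rewrite Ei /=; lia.
Qed.

(** * A box of [n1] elements is the Apery set: Frobenius number, type, almost symmetry *)

Section Apery.
Hypothesis size_box_eq : size box = n1.

(** The [n1] box elements hit all [n1] residues, so no residue is hit twice. *)
Lemma box_mod_inj : {in box &, injective (modn^~ n1)}.
Proof.
have : uniq [seq v %% n1 | v <- box].
  by apply: (leq_size_uniq (iota_uniq 0 n1) box_residues); rewrite size_map size_iota size_box_eq.
move/uniqP=> /(_ 0) inj v w /(nthP 0)[i lti <-] /(nthP 0)[j ltj <-] E.
by congr nth; apply: inj; rewrite ?inE ?size_map // !(nth_map 0).
Qed.

(** The box element covering [s] is congruent to [v], hence equal to [v], yet smaller by a positive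
    multiple of [n1]. *)
Lemma box_apery v s : v \in box -> S s -> v <> n1 + s.
Proof.
move=> vb /S_covered[w wb [m ->]] Ev.
have : v = w by apply: box_mod_inj => //=; rewrite Ev addnC -addnA -mulSnr addnC modnMDl.
by lia.
Qed.

(** Here [v] is the box element congruent to [x], the threshold from which its class belongs to
    [S]. *)
Lemma S_of_ge x : exists2 v, v \in box & (v <= x -> S x) /\ (x < v -> exists m, v = x + m.+1 * n1).
Proof.
have /box_residues/mapP[v vb Ev] : x %% n1 \in iota 0 n1 by rewrite mem_iota /= ltn_mod.
exists v => //; split=> [|lt_xv]; last exact: eq_mod_lt Ev lt_xv.
rewrite leq_eqVlt => /orP[/eqP <- | lt_vx]; first exact: box_S.
have [m ->] := eq_mod_lt (esym Ev) lt_vx.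
exact: S_add (box_S vb) (S_mul1 _).
Qed.

Lemma f_box : f + n1 \in box.
Proof. by rewrite e1 box_top. Qed.

Lemma f_gap : [/\ ~~ S f, ~~ S (f + f) & ~~ S (f + f + f)].
Proof.
split; apply/negP => Sf.
- by apply: (box_apery f_box Sf); rewrite addnC.
- apply: (@box_apery (f + f + n1) _ _ Sf); last by rewrite addnC.
  by rewrite f2_eq box_wall //; lia.
- apply: (@box_apery (f + f + f + n1) _ _ Sf); last by rewrite addnC.
  by rewrite f3_eq box_cell //; lia.
Qed.

(** A nonzero combination contains some generator, and the relation of that generator absorbs
    [f]. *)
Lemma f_pseudo s : S s -> 0 < s -> S (f + s).
Proof.
case/SP=> c1 [c2 [c3 [c4 ->]]] pos; apply/SP.
case: c1 pos => [|c1] pos; last by exists c1, (b2 + c2), c3, c4; lia.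
case: c2 pos => [|c2] pos; last by exists 0, c2, (b3 + c3), c4; lia.
case: c3 pos => [|c3] pos; last by exists 0, 0, c3, (b4 + c4); lia.
by case: c4 pos => [|c4] pos; last by exists b1, 0, 0, c4; lia.
Qed.

(** The largest box element is [3f + n1], and the Frobenius number lies [n1] below the largest Apery
    element. *)
Lemma S_frobenius : frobenius S (f + f + f).
Proof.
split=> [|x lt_x]; first by case: f_gap.
have [v vb [geS ltS]] := S_of_ge x; apply: geS; rewrite leqNgt; apply/negP => /ltS[m Em].
suff : v <= f + f + f + n1 by nia.
case/boxP: vb => [[i [j [k [lti ltj lek ->]]]] | [i lti ->] | ->].
- by rewrite f3_eq; do 2?apply: leq_add; rewrite leq_mul2r; lia.
- have le_i : i * n2 <= b2.-1 * n2 by rewrite leq_mul2r; lia.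
  by have := f2_eq; lia.
- by lia.
Qed.

(** The box element above [x] is completed inside [S] to the largest element of its piece. A cell
    then puts [3f - x] in [S]; on the wall or the top, [2f - x] or [f - x] is in [S], and unless it
    is 0, adding [f] once or twice puts [3f - x] in [S] as well. *)
Lemma S_twin_gap x : x <= f + f + f -> ~~ S x -> ~~ S (f + f + f - x) -> x = f \/ x = f + f.
Proof.
move=> le_x gx gFx.
have noS y : f + f + f = x + y -> ~ S y by move=> Ey Sy; move: gFx; rewrite Ey addKn Sy.
have [v vb [geS ltS]] := S_of_ge x.
have [m Em] : exists m, v = x + m.+1 * n1.
  by apply: ltS; rewrite ltnNge; apply: contra gx.
case/boxP: vb Em => [[i [j [k [lti ltj lek ->]]]] | [i lti ->] | ->] Em.
- case: (noS (m * n1 + (b2.-1 - i) * n2 + (b3.-1 - j) * n3 + (b4 - k) * n4)).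
    have := f3_eq; rewrite !mulnBl.
    have : i * n2 <= b2.-1 * n2 by rewrite leq_mul2r; lia.
    have : j * n3 <= b3.-1 * n3 by rewrite leq_mul2r; lia.
    have : k * n4 <= b4 * n4 by rewrite leq_mul2r; lia.
    by lia.
  by apply/SP; exists m, (b2.-1 - i), (b3.-1 - j), (b4 - k).
- have Ex : f + f = x + (m * n1 + (b2.-1 - i) * n2).
    have := f2_eq; rewrite mulnBl.
    have : i * n2 <= b2.-1 * n2 by rewrite leq_mul2r; lia.
    by lia.
  have [y0|y_gt0] := posnP (m * n1 + (b2.-1 - i) * n2); first by right; lia.
  case: (noS (f + (m * n1 + (b2.-1 - i) * n2))); first by lia.
  by apply: f_pseudo => //; apply/SP; exists m, (b2.-1 - i), 0, 0; lia.
- have Ex : f = x + m * n1 by lia.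
  have [y0|y_gt0] := posnP (m * n1); first by left; lia.
  case: (noS (f + (f + m * n1))); first by lia.
  have Sy := f_pseudo (S_mul1 m) y_gt0.
  by apply: f_pseudo => //; rewrite addn_gt0 y_gt0 orbT.
Qed.

Lemma f_gt0 : 0 < f.
Proof.
rewrite lt0n; apply/eqP => f0; have [/negP[]] := f_gap.
by rewrite f0; apply/SP; exists 0, 0, 0, 0.
Qed.

(** A pseudo-Frobenius number [x] other than [3f] is a twin gap: if [3f - x] were in [S], so would
    be [x + (3f - x)]. *)
Lemma S_type3 : sg_type S 3.
Proof.
have [gf g2f g3f] := f_gap; have f0 := f_gt0.
exists [:: f; f + f; f + f + f]; split; first by rewrite /= !inE; lia.
split=> // x; rewrite !inE; split.
  have ps2 s : S s -> 0 < s -> S (f + f + s).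
    by move=> Ss s0; rewrite -addnA; apply: f_pseudo; [apply: f_pseudo | lia].
  case/or3P=> /eqP->.
  - by split=> // s; apply: f_pseudo.
  - by split=> // s; apply: ps2.
  - by split=> // s Ss s0; apply: (proj2 S_frobenius); lia.
case=> gx px; have le_x := gap_le S_frobenius gx.
have [->|ne_x] := eqVneq x (f + f + f); first by rewrite !orbT.
have [|->|->] := S_twin_gap le_x gx; rewrite ?eqxx ?orbT //.
apply/negP => Sd; move/negP: g3f; apply.
by rewrite -(subnKC le_x) px // subn_gt0 ltn_neqAle ne_x.
Qed.

Lemma S_almost_symmetric : almost_symmetric S.
Proof.
exists (count (predC S) (iota 0 (f + f + f).+1)), (f + f + f), 3.
split; first exact: genus_count S_frobenius.
split; first exact: S_frobenius.
split; first exact: S_type3.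
rewrite (double_gap_count S_add S_frobenius).
have [gf g2f g3f] := f_gap; have f0 := f_gt0.
have -> : count (twin_gap S (f + f + f)) (iota 0 (f + f + f).+1) = size [:: f; f + f].
  rewrite -size_filter; apply/perm_size/uniq_perm; rewrite ?filter_uniq ?iota_uniq //.
    by rewrite /= inE; lia.
  move=> x; rewrite mem_filter mem_iota /= add0n ltnS !inE /twin_gap.
  apply/andP/orP => [[/andP[gx gFx] le_x] | [] /eqP->].
  - by have [->|->] := S_twin_gap le_x gx gFx; rewrite eqxx; [left | right].
  - by rewrite gf (_ : _ - _ = f + f) ?g2f; lia.
  - by rewrite g2f (_ : _ - _ = f) ?gf; lia.
by rewrite /=; lia.
Qed.

(** The other generators are box elements; this yields minimality of the generating set. *)
Lemma gen_apery s : S s -> [/\ n2 <> n1 + s, n3 <> n1 + s & n4 <> n1 + s].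
Proof.
move=> Ss; split; apply: box_apery Ss.
- by have := @box_cell 1 0 0; rewrite !mul0n mul1n !addn0; apply; lia.
- by have := @box_cell 0 1 0; rewrite !mul0n mul1n !addn0; apply; lia.
- by have := @box_cell 0 0 1; rewrite !mul0n mul1n !add0n; apply; lia.
Qed.

End Apery.

(** * Computing [n1] from independence of the generators *)

Section Independence.
Hypotheses (f1_notin : ~~ S f) (f2_notin : ~~ S (f + f)) (f3_notin : ~~ S (f + f + f)).
Hypothesis indep2 : forall k c1 c3 c4, k <= b2 -> k * n2 = c1 * n1 + c3 * n3 + c4 * n4 -> c3 = 0 /\ c4 = 0.
Hypothesis indep3 : forall k c1 c2 c4, k <= b3 -> k * n3 = c1 * n1 + c2 * n2 + c4 * n4 -> c2 = 0 /\ c4 = 0.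
Hypothesis indep4 : forall k c1 c2 c3, k <= b4 -> k * n4 = c1 * n1 + c2 * n2 + c3 * n3 -> c2 = 0 /\ c3 = 0.

Lemma gens_gt0 : [/\ 0 < n2, 0 < n3 & 0 < n4].
Proof.
have p2 : 0 < n2 by rewrite lt0n; apply/eqP => z; move: e1; rewrite z; lia.
have p3 : 0 < n3 by rewrite lt0n; apply/eqP => z; move: e2; rewrite z; lia.
by split=> //; rewrite lt0n; apply/eqP => z; move: e3; rewrite z; lia.
Qed.

(** Cancelling common terms leaves three generators on two sides, so one side is empty or a multiple
    of a single generator, and independence applies. The bounds are inclusive so that wall and top
    are included. *)
Lemma cell_inj i j k i' j' k' : i <= b2 -> j <= b3 -> k <= b4 -> i' <= b2 -> j' <= b3 -> k' <= b4 ->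
  i * n2 + j * n3 + k * n4 = i' * n2 + j' * n3 + k' * n4 -> [/\ i = i', j = j' & k = k'].
Proof.
have [p2 p3 p4] := gens_gt0.
have zero a b : 0 < b -> a * b = 0 -> a = 0.
  by move=> b0 /eqP; rewrite muln_eq0 => /orP[/eqP // | /eqP b0']; lia.
have one2 a b c : a <= b2 -> a * n2 = b * n3 + c * n4 -> [/\ a = 0, b = 0 & c = 0].
  move=> le E; have [|b0 c0] := @indep2 a 0 b c le; first by lia.
  by split=> //; apply: (zero _ n2) => //; rewrite E b0 c0.
have one3 a b c : a <= b3 -> a * n3 = b * n2 + c * n4 -> [/\ a = 0, b = 0 & c = 0].
  move=> le E; have [|b0 c0] := @indep3 a 0 b c le; first by lia.
  by split=> //; apply: (zero _ n3) => //; rewrite E b0 c0.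
have one4 a b c : a <= b4 -> a * n4 = b * n2 + c * n3 -> [/\ a = 0, b = 0 & c = 0].
  move=> le E; have [|b0 c0] := @indep4 a 0 b c le; first by lia.
  by split=> //; apply: (zero _ n4) => //; rewrite E b0 c0.
have diff x y : (exists a, x = y + a) \/ (exists a, y = x + a).
  by have [le|/ltnW le] := leqP y x; [left; exists (x - y) | right; exists (y - x)]; lia.
move=> hi hj hk hi' hj' hk' E.
have [[a Ea]|[a Ea]] := diff i i'; have [[b Eb]|[b Eb]] := diff j j'; have [[c Ec]|[c Ec]] := diff k k';
  rewrite Ea Eb Ec in E hi hj hk hi' hj' hk' *.
- have a0 : a = 0 by apply: (zero a n2) => //; lia.
  have b0 : b = 0 by apply: (zero b n3) => //; lia.
  have c0 : c = 0 by apply: (zero c n4) => //; lia.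
  by split; lia.
- by have [||? ? ?] := @one4 c a b; [lia | lia | split; lia].
- by have [||? ? ?] := @one3 b a c; [lia | lia | split; lia].
- by have [||? ? ?] := @one2 a b c; [lia | lia | split; lia].
- by have [||? ? ?] := @one2 a b c; [lia | lia | split; lia].
- by have [||? ? ?] := @one3 b a c; [lia | lia | split; lia].
- by have [||? ? ?] := @one4 c a b; [lia | lia | split; lia].
- have a0 : a = 0 by apply: (zero a n2) => //; lia.
  have b0 : b = 0 by apply: (zero b n3) => //; lia.
  have c0 : c = 0 by apply: (zero c n4) => //; lia.
  by split; lia.
Qed.

Lemma box_uniq : uniq box.
Proof.
rewrite !cat_uniq; apply/and3P; split.
- apply: allpairs_uniq; rewrite ?iota_uniq //.
    apply: allpairs_uniq; rewrite ?iota_uniq //.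
    move=> _ _ /allpairsP[[j k] [+ + ->]] /allpairsP[[j' k'] [+ + ->]] /=.
    rewrite !mem_iota /= => hj hk hj' hk' E.
    by have [|||||||_ -> ->] := @cell_inj 0 j k 0 j' k'; rewrite //; lia.
  move=> x y /allpairsP[[i w] [hi wt ->]] /allpairsP[[i' w'] [hi' wt' ->]] /=.
  case/allpairsP: wt => -[j k] [hj hk /= Ew]; case/allpairsP: wt' => -[j' k'] [hj' hk' /= Ew'].
  move: hi hj hk hi' hj' hk'; rewrite !mem_iota Ew Ew' /= => hi hj hk hi' hj' hk' E.
  by have [|||||||-> -> ->] := @cell_inj i j k i' j' k'; rewrite //; lia.
- apply/hasPn => v; rewrite mem_cat => /orP Hv; apply/negP.
  move=> /allpairsP[[i w] [hi /allpairsP[[j k] [hj hk /= Ew]] /= Ev]].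
  move: hi hj hk; rewrite !mem_iota /= => hi hj hk.
  case: Hv => [/mapP[i' + Ev'] | ]; last rewrite inE => /eqP Ev'.
    rewrite mem_iota => hi'; have [|||||||_ ? _] := @cell_inj i j k i' b3 0; rewrite //; lia.
  by have [|||||||? _ _] := @cell_inj i j k b2 0 0; rewrite //; lia.
- apply/and3P; split=> //; last first.
    apply/norP; split=> //; apply/negP => /mapP[i]; rewrite mem_iota => hi E.
    by have [|||||||? _ _] := @cell_inj i b3 0 b2 0 0; rewrite //; lia.
  rewrite map_inj_in_uniq ?iota_uniq // => i i'; rewrite !mem_iota /= => hi hi' E.
  by have [|||||||-> _ _] := @cell_inj i b3 0 i' b3 0; rewrite //; lia.
Qed.

(** The gap [h] is [3f], [2f] or [f] according to the piece, and [c] completes [v] to the largest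
    element of that piece. *)
Lemma box_complement v : v \in box -> exists2 h, ~~ S h & exists2 c, S c & v + c = h + n1.
Proof.
case/boxP=> [[i [j [k [lti ltj lek ->]]]] | [i lti ->] | ->].
- have [x Ex] : exists x, b2.-1 = i + x by exists (b2.-1 - i); lia.
  have [y Ey] : exists y, b3.-1 = j + y by exists (b3.-1 - j); lia.
  have [z Ez] : exists z, b4 = k + z by exists (b4 - k); lia.
  exists (f + f + f) => //; exists (x * n2 + y * n3 + z * n4); first by apply/SP; exists 0, x, y, z.
  by have := f3_eq; rewrite Ex Ey [in b4 * _]Ez; lia.
- have [x Ex] : exists x, b2.-1 = i + x by exists (b2.-1 - i); lia.
  exists (f + f) => //; exists (x * n2); first by apply/SP; exists 0, x, 0, 0; lia.
  by have := f2_eq; rewrite Ex; lia.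
- by exists f => //; exists 0; [apply/SP; exists 0, 0, 0, 0 | rewrite addn0].
Qed.

(** If [w] exceeded [v] by a positive multiple of [n1], completing [w] to [h + n1] would write the
    gap [h] as [v] plus elements of [S]. *)
Lemma box_mod_le v w : v \in box -> w \in box -> v %% n1 = w %% n1 -> w <= v.
Proof.
move=> vb wb E; rewrite leqNgt; apply/negP => lt.
have [h gh [c Sc Ec]] := box_complement wb.
have [m Em] := eq_mod_lt E lt.
move/negP: gh; apply; have -> : h = v + m * n1 + c by lia.
by apply: S_add Sc; apply: S_add; [apply: box_S | apply: S_mul1].
Qed.

(** The box meets every class modulo [n1], and each exactly once. With [size_box] this is the
    formula for the generator. *)
Lemma size_box_n1 : size box = n1.
Proof.
apply/anti_leq; rewrite n1_le_size_box andbT -(size_map (modn^~ n1)) -{2}(size_iota 0 n1).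
apply: uniq_leq_size => [|r /mapP[v _ ->]]; last by rewrite mem_iota ltn_mod.
rewrite map_inj_in_uniq ?box_uniq // => v w vb wb E.
by apply/anti_leq; rewrite !box_mod_le.
Qed.

End Independence.
End Cycle.

(** * Direct part: the explicit generators *)

Lemma in_gen_gcd_cofinite (gs : seq nat) :
  exists N, forall x, N <= x -> gcd_seq gs %| x -> in_gen gs x.
Proof.
elim: gs => [|g gs [N HN]]; first by exists 0 => x _; rewrite dvd0n.
rewrite /gcd_seq /= -/(gcd_seq gs); have [d0|d_gt0] := posnP (gcd_seq gs).
  (* All remaining generators vanish, so [x] is a multiple of [g]. *)
  exists N => x le_x; rewrite d0 gcdn0 => /dvdnP[k ->].
  apply/in_gen_cons; exists k, 0; rewrite addn0; split=> //.
  elim: gs d0 {HN} => [|h hs IH] //= /eqP; rewrite -/(gcd_seq hs) => /eqP d0.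
  have /andP[_ /eqP/IH H] : (h == 0) && (gcd_seq hs == 0).
    by rewrite -!dvd0n -dvdn_gcd d0.
  by apply/in_gen_cons; exists 0, 0.
set d := gcd_seq gs in HN d_gt0 *; exists (N + d * g) => x le_x /dvdnP[c Ec].
(* Since [d] divides [gcdn d g + a * g], the number [x = c * gcdn g d] is congruent to
   [c * (d - a) * g] modulo [d]; here [d - a] stands for the negative of [a]. Reducing the
   coefficient modulo [d] keeps [x - k * g] above [N]. *)
have [a lt_ad Ha] := Bezoutl g d_gt0.
pose k := (c * (d - a)) %% d.
have lt_kd : k < d by rewrite ltn_mod.
have le_kg : k * g <= d * g by rewrite leq_mul2r ltnW ?orbT.
have dvd_x : d %| x - k * g.
  rewrite -eqn_mod_dvd; last by lia.
  rewrite -(eqn_modDr (c * (a * g))) -(modnDml (k * g)) modnMml modnDml.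
  have -> : x + c * (a * g) = c * (gcdn d g + a * g) by rewrite Ec gcdnC; lia.
  have -> : c * (d - a) * g + c * (a * g) = c * g * d.
    by rewrite -[in RHS](subnK (ltnW lt_ad)); lia.
  by rewrite modnMl; apply: dvdn_mull.
apply/in_gen_cons; exists k, (x - k * g); split; last by lia.
by apply: HN => //; lia.
Qed.

(** It carries statements about the first generator over to the other three. *)
Lemma eq_in_gen_rot (g : nat) (gs : seq nat) : in_gen (rcons gs g) =1 in_gen (g :: gs).
Proof.
elim: gs => [|h gs IH] x //; apply/idP/idP.
  case/in_gen_cons=> k [y []]; rewrite IH => /in_gen_cons[l [z [Hz ->]]] ->.
  apply/in_gen_cons; exists l, (k * h + z); split; last by lia.
  by apply/in_gen_cons; exists k, z.
case/in_gen_cons=> l [y [/in_gen_cons[k [z [Hz ->]]] ->]].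
apply/in_gen_cons; exists k, (l * g + z); split; last by lia.
by rewrite IH; apply/in_gen_cons; exists l, z.
Qed.

(** With [b_i = a_i - 1] both sides equal [b1 b2 b3 b4 + b2 b3 b4 + b2 b3 + b2]; positivity of the
    product makes the truncated [- 1] in [f] exact. *)
Lemma gens4_cyclic (a1 a2 a3 a4 : nat) (f := (a1 - 1) * (a2 - 1) * (a3 - 1) * (a4 - 1) - 1)
    (n1 := (a2 - 1) * (a3 - 1) * a4 + a2) (n2 := (a3 - 1) * (a4 - 1) * a1 + a3) :
  1 < a1 -> 1 < a2 -> 1 < a3 -> 1 < a4 -> f + n1 = (a2 - 1) * n2.
Proof.
rewrite /f /n1 /n2 {f n1 n2}; case: a1 a2 a3 a4 => [|b1] [|b2] [|b3] [|b4] //.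
rewrite !subn1 /= !ltnS => ? ? ? ?.
have : 0 < b1 * b2 * b3 * b4 by rewrite !muln_gt0; lia.
nia.
Qed.

Lemma gens4_apery (a1 a2 a3 a4 : nat) (S := in_gen (gens4 a1 a2 a3 a4))
    (n1 := (a2 - 1) * (a3 - 1) * a4 + a2) (n2 := (a3 - 1) * (a4 - 1) * a1 + a3)
    (n3 := (a4 - 1) * (a1 - 1) * a2 + a4) (n4 := (a1 - 1) * (a2 - 1) * a3 + a1) :
  2 < a1 -> 2 < a2 -> 2 < a3 -> 2 < a4 -> (exists N, forall x, N <= x -> S x) ->
  [/\ almost_symmetric S, sg_type S 3 &
      forall s, S s -> [/\ n2 <> n1 + s, n3 <> n1 + s & n4 <> n1 + s]].
Proof.
move=> h1 h2 h3 h4 cof.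
have [g1 g2 g3 g4] : [/\ 1 < a1 - 1, 1 < a2 - 1, 1 < a3 - 1 & 1 < a4 - 1] by split; lia.
pose f := (a1 - 1) * (a2 - 1) * (a3 - 1) * (a4 - 1) - 1.
have e1 : f + n1 = (a2 - 1) * n2 by apply: gens4_cyclic; lia.
have e2 : f + n2 = (a3 - 1) * n3 by rewrite -(@gens4_cyclic a2 a3 a4 a1) /f; lia.
have e3 : f + n3 = (a4 - 1) * n4 by rewrite -(@gens4_cyclic a3 a4 a1 a2) /f; lia.
have e4 : f + n4 = (a1 - 1) * n1 by rewrite -(@gens4_cyclic a4 a1 a2 a3) /f; lia.
have n1_gt0 : 0 < n1 by rewrite /n1; lia.
have SP x : S x <-> exists c1 c2 c3 c4, x = c1 * n1 + c2 * n2 + c3 * n3 + c4 * n4.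
  exact: in_gen4P.
have sz : size (box n2 n3 n4 (a2 - 1) (a3 - 1) (a4 - 1)) = n1.
  by rewrite size_box /n1; do 2!(rewrite -subSn; last by lia); rewrite !subn1.
split.
- exact: (@S_almost_symmetric n1 n2 n3 n4 f (a1 - 1) (a2 - 1) (a3 - 1) (a4 - 1)).
- exact: (@S_type3 n1 n2 n3 n4 f (a1 - 1) (a2 - 1) (a3 - 1) (a4 - 1)).
- exact: (@gen_apery n1 n2 n3 n4 f (a1 - 1) (a2 - 1) (a3 - 1) (a4 - 1)).
Qed.

(** Every nonzero element of [S] is a generator plus an element of [S]. When the whole is itself a
    generator, the hypotheses force the two generators to be equal and the remainder to be 0. *)
Lemma min_gen4P (S : pred nat) (n1 n2 n3 n4 : nat) :
  (forall x, S x <-> exists c1 c2 c3 c4, x = c1 * n1 + c2 * n2 + c3 * n3 + c4 * n4) ->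
  0 < n1 -> 0 < n2 -> 0 < n3 -> 0 < n4 ->
  (forall s, S s -> [/\ n2 <> n1 + s, n3 <> n1 + s & n4 <> n1 + s]) ->
  (forall s, S s -> [/\ n3 <> n2 + s, n4 <> n2 + s & n1 <> n2 + s]) ->
  (forall s, S s -> [/\ n4 <> n3 + s, n1 <> n3 + s & n2 <> n3 + s]) ->
  (forall s, S s -> [/\ n1 <> n4 + s, n2 <> n4 + s & n3 <> n4 + s]) ->
  uniq [:: n1; n2; n3; n4] /\ forall x, x \in [:: n1; n2; n3; n4] <-> min_gen S x.
Proof.
move=> SP p1 p2 p3 p4 ap1 ap2 ap3 ap4; set gs := [:: n1; n2; n3; n4].
have S0 : S 0 by apply/SP; exists 0, 0, 0, 0.
have gsE x : x \in gs = [|| x == n1, x == n2, x == n3 | x == n4] by rewrite !inE.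
have gensS x : x \in gs -> S x.
  rewrite gsE => /or4P[] /eqP->; apply/SP.
  - by exists 1, 0, 0, 0; lia.
  - by exists 0, 1, 0, 0; lia.
  - by exists 0, 0, 1, 0; lia.
  - by exists 0, 0, 0, 1; lia.
have gen_part x : S x -> 0 < x -> exists2 y, y \in gs & exists2 s, S s & x = y + s.
  case/SP=> c1 [c2 [c3 [c4 ->]]] pos.
  case: c1 pos => [|c1] pos; last first.
    exists n1; first by rewrite gsE eqxx.
    by exists (c1 * n1 + c2 * n2 + c3 * n3 + c4 * n4); [apply/SP; exists c1, c2, c3, c4 | lia].
  case: c2 pos => [|c2] pos; last first.
    exists n2; first by rewrite gsE eqxx orbT.
    by exists (c2 * n2 + c3 * n3 + c4 * n4); [apply/SP; exists 0, c2, c3, c4; lia | lia].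
  case: c3 pos => [|c3] pos; last first.
    exists n3; first by rewrite gsE eqxx !orbT.
    by exists (c3 * n3 + c4 * n4); [apply/SP; exists 0, 0, c3, c4; lia | lia].
  case: c4 pos => [|c4] pos //; exists n4; first by rewrite gsE eqxx !orbT.
  by exists (c4 * n4); [apply/SP; exists 0, 0, 0, c4; lia | lia].
have irred x y s : x \in gs -> y \in gs -> S s -> x = y + s -> x = y.
  rewrite !gsE => xg yg Ss.
  have [? ? ?] := ap1 s Ss; have [? ? ?] := ap2 s Ss.
  have [? ? ?] := ap3 s Ss; have [? ? ?] := ap4 s Ss.
  by case/or4P: xg => /eqP->; case/or4P: yg => /eqP->.
have gens_gt0 x : x \in gs -> 0 < x by rewrite gsE => /or4P[] /eqP->.
split.
  have [? ? ?] := ap1 0 S0; have [? ? ?] := ap2 0 S0; have [? ? ?] := ap3 0 S0.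
  by rewrite /= !inE; lia.
move=> x; split=> [xg | [x0 [Sx irr]]].
  split; first exact: gens_gt0.
  split; first exact: gensS.
  case=> [a [b [a0 [b0 [Sa [Sb Eab]]]]]].
  have [y yg [s Ss Ea]] := gen_part a Sa a0.
  by have := irred x y (s + b) xg yg (S_add SP Ss Sb); lia.
have [y yg [s Ss Ex]] := gen_part x Sx x0.
have [s0|s_gt0] := posnP s; first by rewrite Ex s0 addn0.
by case: irr; exists y, s; do !split=> //; [exact: gens_gt0 | exact: gensS].
Qed.

Theorem gens4_almost_symmetric (a1 a2 a3 a4 : nat) (S := in_gen (gens4 a1 a2 a3 a4)) :
  odd a1 -> odd a2 -> odd a3 -> odd a4 -> 1 < a1 -> 1 < a2 -> 1 < a3 -> 1 < a4 ->
  gcd_seq (gens4 a1 a2 a3 a4) = 1 ->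
  numerical_semigroup S /\ embdim S 4 /\
  all odd (gens4 a1 a2 a3 a4) /\ (forall x, min_gen S x -> odd x) /\
  almost_symmetric S /\ sg_type S 3.
Proof.
move=> o1 o2 o3 o4 h1 h2 h3 h4 gcd1.
have {h1 h2 h3 h4} [h1 h2 h3 h4] : [/\ 2 < a1, 2 < a2, 2 < a3 & 2 < a4].
  by split; lia.
have cof : exists N, forall x, N <= x -> S x.
  have [N HN] := in_gen_gcd_cofinite (gens4 a1 a2 a3 a4).
  by exists N => x le_x; apply: HN => //; rewrite gcd1 dvd1n.
(* The generators are permuted cyclically with the parameters, so [gens4_apery] applies to each of
   them in first position. *)
have rot1 : in_gen (gens4 a2 a3 a4 a1) =1 S by move=> x; exact: (eq_in_gen_rot _ [:: _; _; _]).
have rot2 : in_gen (gens4 a3 a4 a1 a2) =1 S by move=> x; rewrite -rot1; exact: (eq_in_gen_rot _ [:: _; _; _]).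
have rot3 : in_gen (gens4 a4 a1 a2 a3) =1 S by move=> x; rewrite -rot2; exact: (eq_in_gen_rot _ [:: _; _; _]).
have cof_eq T : T =1 S -> exists N, forall x, N <= x -> T x.
  by move=> TS; have [N HN] := cof; exists N => x /HN; rewrite TS.
have [asym type3 ap1] := gens4_apery h1 h2 h3 h4 cof.
have [_ _ ap2] := gens4_apery h2 h3 h4 h1 (cof_eq _ rot1).
have [_ _ ap3] := gens4_apery h3 h4 h1 h2 (cof_eq _ rot2).
have [_ _ ap4] := gens4_apery h4 h1 h2 h3 (cof_eq _ rot3).
pose n1 := (a2 - 1) * (a3 - 1) * a4 + a2.
pose n2 := (a3 - 1) * (a4 - 1) * a1 + a3.
pose n3 := (a4 - 1) * (a1 - 1) * a2 + a4.
pose n4 := (a1 - 1) * (a2 - 1) * a3 + a1.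
have SP x : S x <-> exists c1 c2 c3 c4, x = c1 * n1 + c2 * n2 + c3 * n3 + c4 * n4.
  exact: in_gen4P.
have S0 : S 0 by apply/SP; exists 0, 0, 0, 0.
have Sadd := S_add SP.
have all_odd : all odd (gens4 a1 a2 a3 a4).
  have gen_odd a x y : odd a -> odd ((a - 1) * x * y + a).
    by case: a => // a; rewrite subn1 /= oddD !oddM /= => /negbTE->.
  by rewrite /= !gen_odd.
have [gens_uniq min_genP] : uniq (gens4 a1 a2 a3 a4) /\
    forall x, x \in gens4 a1 a2 a3 a4 <-> min_gen S x.
  have /and5P[m1 m2 m3 m4 _] := all_odd.
  apply: (min_gen4P SP); try exact: odd_gt0.
  - by move=> s /ap1.
  - by move=> s; rewrite -rot1 => /ap2.
  - by move=> s; rewrite -rot2 => /ap3.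
  - by move=> s; rewrite -rot3 => /ap4.
split; first by split.
split; first by exists (gens4 a1 a2 a3 a4).
split=> //; split; last by split.
by move=> x /min_genP /(allP all_odd).
Qed.

(** * Row factorizations and averaging *)

(** Coefficient vectors are functions of which only the values at 0, 1, 2, 3 matter. *)
Definition comb (n v : nat -> nat) : nat := v 0 * n 0 + v 1 * n 1 + v 2 * n 2 + v 3 * n 3.
Definition delta (i x : nat) : nat := x == i.
Definition vadd (u v : nat -> nat) (x : nat) : nat := u x + v x.

Notation quad := (bool * bool * bool * bool)%type.
Definition mkquad (p : nat -> bool) : quad := (p 0, p 1, p 2, p 3).
Definition xorq (p q : quad) : quad :=
  (p.1.1.1 (+) q.1.1.1, p.1.1.2 (+) q.1.1.2, p.1.2 (+) q.1.2, p.2 (+) q.2).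
Definition unitq (i : nat) : quad := mkquad (fun x => x == i).
Definition par (v : nat -> nat) : quad := mkquad (fun x => odd (v x)).

Lemma xorq_solve (p q u v : quad) :
  xorq p q = xorq u v -> xorq (xorq q p) u = v /\ xorq (xorq v p) u = q.
Proof.
have solve (a b c d : bool) : a (+) b = c (+) d -> (b (+) a) (+) c = d /\ (d (+) a) (+) c = b.
  by case: a b c d => [] [] [] [].
case: p q u v => [[[p0 p1] p2] p3] [[[q0 q1] q2] q3] [[[u0 u1] u2] u3] [[[v0 v1] v2] v3].
rewrite /xorq /= => -[/solve[? ?] /solve[? ?] /solve[? ?] /solve[? ?]].
by split; congr (_, _, _, _).
Qed.

Lemma lt4_ind (P : nat -> Prop) : P 0 -> P 1 -> P 2 -> P 3 -> forall i, i < 4 -> P i.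
Proof. by move=> P0 P1 P2 P3 [|[|[|[|]]]]. Qed.

Lemma combD n u v : comb n (vadd u v) = comb n u + comb n v.
Proof. by rewrite /comb /vadd; lia. Qed.

Lemma comb_delta n i : i < 4 -> comb n (delta i) = n i.
Proof. by move: i; apply: lt4_ind; rewrite /comb /delta /=; lia. Qed.

Lemma eq_comb n u v : (forall x, x < 4 -> u x = v x) -> comb n u = comb n v.
Proof. by move=> E; rewrite /comb !E. Qed.

Lemma parD u v : par (vadd u v) = xorq (par u) (par v).
Proof. by rewrite /par /mkquad /vadd !oddD. Qed.

Lemma par_delta i : par (delta i) = unitq i.
Proof. by rewrite /par /mkquad /delta !oddb. Qed.

Lemma par_eq u v x : par u = par v -> x < 4 -> odd (u x) = odd (v x).
Proof. by case=> E0 E1 E2 E3; move: x; apply: lt4_ind. Qed.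

Lemma comb_sub n u v : (forall x, x < 4 -> u x <= v x) ->
  comb n v = comb n u + comb n (fun x => v x - u x).
Proof. by move=> le; rewrite -combD; apply: eq_comb => x /le; rewrite /vadd; lia. Qed.

(** The vector [(w - d) / 2] is integral by congruence modulo 2 and nonnegative by [d <= w]. *)
Lemma halve n w d s : par w = par d -> (forall x, x < 4 -> d x <= w x) ->
  comb n w = comb n d + s.*2 ->
  exists2 v, comb n v = s & forall x, x < 4 -> w x = d x + (v x).*2.
Proof.
move=> pe le E; have [v Ew] : exists v, forall x, x < 4 -> w x = d x + (v x).*2.
  exists (fun x => (w x - d x)./2) => x ltx.
  by rewrite halfK oddB ?le // (par_eq pe ltx) addbb subn0 subnKC ?le.
exists v => //; suff : comb n w = comb n d + (comb n v).*2 by rewrite E; lia.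
by rewrite /comb !Ew //; lia.
Qed.

(** Equal parity settles the entries 0 and 1 of the subtracted vector; only an entry 2 needs an
    argument. *)
Lemma le_of_parity (a b : nat) : odd b = odd a -> a <= 2 -> (a = 2 -> 0 < b) -> a <= b.
Proof. by case: a b => [|[|[|a]]] [|[|b]] //= _ _ /(_ erefl). Qed.

Section RowFactorization.
Variables (n : nat -> nat) (S : pred nat).
Hypothesis SP : forall x, S x <-> exists v, x = comb n v.

(** With the diagonal entry -1 moved to the other side, [v] is the [i]-th row of a row factorization
    matrix of [h]. *)
Definition fac (h i : nat) (v : nat -> nat) : Prop := comb n v = h + n i.
(** The guard makes the truncated subtraction exact. An arrow means that some factorization of
    [h + n i] uses [n j]. *)
Definition arrow (h i j : nat) : bool := (n j <= h + n i) && S (h + n i - n j).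

Lemma S_comb v : S (comb n v). Proof. by apply/SP; exists v. Qed.

Lemma arrow_fac h i j : j < 4 -> arrow h i j -> exists2 v, fac h i v & 0 < v j.
Proof.
move=> ltj /andP[le /SP[v Ev]]; exists (vadd v (delta j)); last by rewrite /vadd /delta eqxx; lia.
by rewrite /fac combD comb_delta //; lia.
Qed.

Lemma fac_arrow h i v x : x < 4 -> fac h i v -> 0 < v x -> arrow h i x.
Proof.
move=> ltx Fv v_gt0; have le y : y < 4 -> delta x y <= v y.
  by move=> _; rewrite /delta; case: eqP => [->|].
have := comb_sub n le; rewrite Fv comb_delta // => E.
by rewrite /arrow E leq_addr addKn S_comb.
Qed.

Lemma fac_le_irr h i k u v : fac h i u -> fac h k v -> (forall x, x < 4 -> u x <= v x) ->
  exists2 s, S s & n k = n i + s.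
Proof.
move=> Fu Fv le; exists (comb n (fun x => v x - u x)); first exact: S_comb.
by have := comb_sub n le; rewrite Fu Fv; lia.
Qed.

(** The sum [u + v] represents [2h + n i + n j]; removing one [n i] and one [n j] leaves an even
    vector, whose half represents [h]. *)
Lemma average_same h i j u v : i < 4 -> j < 4 -> i <> j -> fac h i u -> fac h j v ->
  xorq (par u) (par v) = xorq (unitq i) (unitq j) -> S h.
Proof.
move=> lti ltj ne Fu Fv; rewrite -!par_delta -!parD => pe.
have [||w <- _] := @halve n _ _ h pe; last exact: S_comb.
  move=> x ltx; apply: le_of_parity; rewrite ?(par_eq pe) //; rewrite /vadd /delta.
    by do 2!case: eqP.
  by do 2!case: eqP => //; lia.
by rewrite !combD !comb_delta // Fu Fv; lia.
Qed.

(** All four rows are summed and one copy of each of the four indexed generators removed. An index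
    met twice is [i] or [j], where [a' i] or [a j] supplies the positive entry that parity raises to
    2. *)
Lemma average_mixed h k i j p q a a' b b' :
  i < 4 -> j < 4 -> p < 4 -> q < 4 -> i <> j -> p <> q ->
  fac h i a -> 0 < a j -> fac h j a' -> 0 < a' i -> fac k p b -> fac k q b' ->
  xorq (xorq (par a) (par a')) (xorq (par b) (par b'))
    = xorq (xorq (unitq i) (unitq j)) (xorq (unitq p) (unitq q)) -> S (h + k).
Proof.
move=> lti ltj ltp ltq neij nepq Fa aj Fa' a'i Fb Fb'; rewrite -!par_delta -!parD => pe.
have [||w <- _] := @halve n _ _ (h + k) pe; last exact: S_comb.
  move=> x ltx; apply: le_of_parity; rewrite ?(par_eq pe) //; rewrite /vadd /delta.
    by do 4!case: eqP => /=; lia.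
  case: (x =P i) => [->|nei]; first by lia.
  case: (x =P j) => [->|nej]; first by lia.
  by do 2!case: eqP => /=; lia.
by rewrite !combD !comb_delta // Fa Fa' Fb Fb'; lia.
Qed.

Definition supported (h i : nat) (T : pred nat) : Prop := forall x, x < 4 -> arrow h i x -> T x.

Lemma fac_supported h i (T : pred nat) v x :
  supported h i T -> fac h i v -> x < 4 -> ~~ T x -> v x = 0.
Proof.
move=> sup Fv ltx nTx; apply/eqP; rewrite -leqn0 leqNgt; apply: contra nTx => v_gt0.
exact: sup (fac_arrow ltx Fv v_gt0).
Qed.

Section PseudoFrobenius.
Variables (h k : nat).
Hypotheses (h_gap : ~~ S h) (neq_hk : h <> k).
Hypothesis k_pseudo : forall s, S s -> 0 < s -> S (k + s).

(** Otherwise [h] is [k] plus an element of [S], nonzero since [h <> k], and [k] being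
    pseudo-Frobenius puts [h] in [S]. *)
Lemma fac_not_le i u v : fac h i u -> fac k i v -> ~ (forall x, x < 4 -> v x <= u x).
Proof.
move=> Fu Fv le; have := comb_sub n le; rewrite Fu Fv => E.
have {}E : h = k + comb n (fun x => u x - v x) by lia.
have [s0|s_gt0] := posnP (comb n (fun x => u x - v x)); first by lia.
by move: h_gap; rewrite E k_pseudo ?S_comb.
Qed.

Lemma fac_single_lt i s u v : supported k i (pred1 s) -> fac h i u -> fac k i v -> u s < v s.
Proof.
move=> sup Fu Fv; rewrite ltnNge; apply/negP => le; apply: (fac_not_le Fu Fv) => x ltx.
have [->//|ne] := eqVneq x s.
by rewrite (fac_supported sup Fv ltx).
Qed.

(* The four factorizations combine to the relation [a + b' = c + b], which is even; half of it can be added to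
   [c] or subtracted from [b], whichever stays nonnegative, and brings in the forbidden generator [r]. *)
Lemma half_relation i j s t r a c b b' :
  i < 4 -> j < 4 -> r < 4 -> r <> s -> r <> t ->
  supported k i (pred1 t) -> supported k j (pred1 s) -> supported h j (pred2 s t) ->
  fac k i b -> par b = unitq t -> fac k j b' -> par b' = unitq s ->
  fac h i a -> 0 < a r -> fac h j c ->
  xorq (par a) (par c) = xorq (unitq s) (unitq t) -> False.
Proof.
move=> lti ltj ltr ners nert sbi sbj saj Fb pb Fb' pb' Fa ar Fc pe.
have b0 x : x < 4 -> x <> t -> b x = 0.
  by move=> ltx ne; apply: (fac_supported sbi Fb ltx); apply/eqP.
have b'0 x : x < 4 -> x <> s -> b' x = 0.
  by move=> ltx ne; apply: (fac_supported sbj Fb' ltx); apply/eqP.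
have c0 x : x < 4 -> x <> s -> x <> t -> c x = 0.
  by move=> ltx nes net; apply: (fac_supported saj Fc ltx); apply/norP; split; apply/eqP.
(* Here [(c + a + b' - b) / 2] is a factorization of [h + n j] that uses [n r], outside the support
   allowed to [j]. *)
have [le|gt] := leqP (b t) (c t + a t).
  have p1 : par (vadd (vadd c a) b') = par b.
    by rewrite !parD pb pb'; exact: (proj1 (xorq_solve pe)).
  have [||v Fv Ev] := @halve n _ _ (h + n j) p1.
  - move=> x ltx; case: (x =P t) => [->|ne]; last by rewrite b0.
    by rewrite /vadd; lia.
  - by rewrite !combD Fc Fa Fb Fb'; lia.
  have : 0 < v r by have := Ev r ltr; rewrite /vadd b0 // b'0 // c0 //; lia.
  by move/(fac_arrow ltr Fv)/saj => /(_ ltr) /orP[] /eqP.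
(* Now [(b + a + b' - c) / 2] is a factorization of [k + n i] that uses [n r]; at [s] it is
   nonnegative by [fac_single_lt]. *)
have p2 : par (vadd (vadd b a) b') = par c.
  by rewrite !parD pb pb'; exact: (proj2 (xorq_solve pe)).
have [||v Fv Ev] := @halve n _ _ (k + n i) p2.
- move=> x ltx; case: (x =P s) => [->|nes].
    by have := fac_single_lt sbj Fc Fb'; rewrite /vadd; lia.
  by case: (x =P t) => [->|net]; [rewrite /vadd; lia | rewrite c0].
- by rewrite !combD Fc Fa Fb Fb'; lia.
have : 0 < v r by have := Ev r ltr; rewrite /vadd b0 // b'0 // c0 //; lia.
by move/(fac_arrow ltr Fv)/sbi => /(_ ltr) /eqP.
Qed.

End PseudoFrobenius.
End RowFactorization.

(** * The finite case analysis *)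

Definition idx4 : seq nat := [:: 0; 1; 2; 3].
Definition mat (E : rel nat) : seq bitseq := [seq [seq E i j | j <- idx4] | i <- idx4].
Definition ent (M : seq bitseq) (i j : nat) : bool := nth false (nth [::] M i) j.
(** By [arrow_dual], the matrix for [g] when [M] is the matrix for [f]. *)
Definition comat (M : seq bitseq) : seq bitseq := mat (fun i j => (i != j) && ~~ ent M j i).
Definition mat_of_adj (adj : seq (seq nat)) : seq bitseq := mat (fun i j => j \in nth [::] adj i).
Definition relabel (M : seq bitseq) (p : seq nat) : seq bitseq :=
  mat (fun i j => ent M (nth 0 p i) (nth 0 p j)).

Lemma mem_idx4 x : (x \in idx4) = (x < 4).
Proof. by case: x => [|[|[|[|x]]]]. Qed.

Lemma ent_mat E i j : ent (mat E) i j = [&& i < 4, j < 4 & E i j].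
Proof. by case: i j => [|[|[|[|i]]]] [|[|[|[|j]]]]; rewrite /ent //= ?nth_nil ?andbF. Qed.

Lemma eq_mat (E E' : rel nat) : (forall i j, i < 4 -> j < 4 -> E i j = E' i j) -> mat E = mat E'.
Proof. by move=> eqE; rewrite /mat /= !eqE. Qed.

(** Necessary conditions on the digraph: each [h + n i] has a factorization, and multiples of one
    common generator are comparable, which forbids repeated singleton rows. *)
Definition graph_ok (M : seq bitseq) : bool :=
  let N := comat M in
  [&& all (has id) M, all (has id) N,
      uniq [seq r <- M | count id r == 1], uniq [seq r <- N | count id r == 1] &
      all2 (fun r r' => ~~ ((count id r == 1) && (r == r'))) M N].

Definition four_cycle : seq bitseq := mat_of_adj [:: [:: 1]; [:: 2]; [:: 3]; [:: 0]].

(** The constructors stand for uses of [average_same], [average_mixed] and [half_relation]. *)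
Inductive clue : Type :=
  | Same of nat & nat | Mixed of nat & nat & nat & nat | Half of nat & nat & nat & nat.

(* For each digraph of arcs [f + n_i - n_j \in S]: arcs of that digraph ([true]) and of its counterpart for
   [g] ([false]), and the averaging arguments, given by positions in this list of arcs, which together exclude
   all parities of the corresponding factorizations. *)
Definition refutations : seq (seq (seq nat) * seq (bool * nat * nat) * seq clue) := [::
  ([:: [:: 2; 3]; [:: 2; 3]; [:: 0; 1]; [:: 0; 1]],
   [:: (false, 0, 1); (false, 1, 0)],
   [:: Same 0 1]);
  ([:: [:: 3]; [:: 2]; [:: 1; 3]; [:: 0; 2]],
   [:: (false, 0, 1); (false, 1, 0); (false, 2, 0); (false, 3, 1)],
   [:: Same 0 2; Same 0 1; Same 1 3]);
  ([:: [:: 3]; [:: 2; 3]; [:: 0; 1]; [:: 0; 1]],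
   [:: (false, 0, 1); (false, 1, 0)],
   [:: Same 0 1]);
  ([:: [:: 3]; [:: 2; 3]; [:: 0]; [:: 0; 1]],
   [:: (true, 0, 3); (true, 2, 0); (false, 0, 1); (false, 1, 0)],
   [:: Same 2 3; Mixed 2 3 0 1]);
  ([:: [:: 3]; [:: 2]; [:: 1]; [:: 0]],
   [:: (true, 0, 3); (true, 3, 0); (false, 0, 1); (false, 1, 0); (false, 2, 0)],
   [:: Same 2 3; Same 2 4; Mixed 0 1 2 3; Mixed 0 1 2 4]);
  ([:: [:: 3]; [:: 2]; [:: 1]; [:: 0; 2]],
   [:: (true, 1, 2); (true, 2, 1); (false, 0, 1); (false, 2, 0)],
   [:: Same 2 3; Mixed 0 1 2 3]);
  ([:: [:: 3]; [:: 2]; [:: 1; 3]; [:: 0; 1]],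
   [:: (true, 0, 3); (true, 1, 2); (true, 3, 0); (false, 1, 0); (false, 3, 1)],
   [:: Mixed 0 2 3 4; Half 3 4 1 2]);
  ([:: [:: 3]; [:: 2; 3]; [:: 0; 1]; [:: 0]],
   [:: (true, 0, 3); (true, 3, 0); (false, 0, 1); (false, 1, 0)],
   [:: Same 2 3; Mixed 0 1 2 3]);
  ([:: [:: 3]; [:: 2; 3]; [:: 0; 1]; [:: 0; 2]],
   [:: (true, 0, 3); (true, 2, 1); (true, 3, 0); (false, 0, 1); (false, 2, 0); (false, 3, 2)],
   [:: Mixed 0 2 4 5; Half 3 4 0 1; Half 4 5 1 2]);
  ([:: [:: 3]; [:: 2]; [:: 0; 1]; [:: 0; 1]],
   [:: (false, 0, 1); (false, 1, 0)],
   [:: Same 0 1]);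
  ([:: [:: 3]; [:: 2]; [:: 0]; [:: 0; 1]],
   [:: (true, 0, 3); (true, 2, 0); (false, 0, 1); (false, 1, 0)],
   [:: Same 2 3; Mixed 2 3 0 1]);
  ([:: [:: 2; 3]; [:: 0; 3]; [:: 0; 1]; [:: 1; 2]],
   [:: (true, 0, 2); (true, 1, 3); (true, 2, 0); (true, 3, 1); (false, 0, 3); (false, 1, 0); (false, 2, 1); (false, 3, 2)],
   [:: Mixed 1 3 4 5; Mixed 1 3 4 7; Half 4 5 0 1; Half 5 6 1 2; Half 6 7 2 3; Half 7 4 3 0]);
  ([:: [:: 3]; [:: 2]; [:: 0; 3]; [:: 1; 2]],
   [:: (true, 0, 3); (true, 1, 2); (true, 2, 3); (true, 3, 2); (false, 0, 1); (false, 1, 0); (false, 2, 0); (false, 3, 1)],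
   [:: Same 4 5; Mixed 2 3 4 5; Mixed 2 3 4 6; Mixed 2 3 4 7; Mixed 4 5 0 2; Mixed 2 3 5 6; Mixed 4 5 0 3; Mixed 4 5 1 2; Mixed 4 5 1 3])].

(** The bits are the off-diagonal entries row by row; a loop would put a gap in [S]. *)
Definition mat_of_bits (e : bitseq) : seq bitseq :=
  if e is [:: a; b; c; d; x; y; z; t; u; v; w; s] then
    [:: [:: false; a; b; c]; [:: d; false; x; y]; [:: z; t; false; u]; [:: v; w; s; false]]
  else [::].

Fixpoint all_bits (k : nat) (P : pred bitseq) : bool :=
  if k is k'.+1 then all_bits k' (fun s => P (true :: s)) && all_bits k' (fun s => P (false :: s))
  else P [::].

Lemma all_bitsP k (P : pred bitseq) s : all_bits k P -> size s = k -> P s.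
Proof.
elim: k P s => [|k IH] P [|b s] //= /andP[Pt Pf] [Es].
by case: b; [apply: IH Pt Es | apply: IH Pf Es].
Qed.

(** Exhaustive evaluation over the [2^12] loopless digraphs on four vertices. *)
Lemma graph_classification :
  let ps := permutations idx4 in
  let gs := four_cycle :: [seq mat_of_adj r.1.1 | r <- refutations] in
  all_bits 12 (fun e => let M := mat_of_bits e in
    graph_ok M ==> has (fun p => relabel M p \in gs) ps).
Proof. by lazy. Qed.

Definition quads : seq quad :=
  [seq (x.1, x.2, y.1, y.2) | x <- [seq (a, b) | a <- [:: true; false], b <- [:: true; false]],
                              y <- [seq (a, b) | a <- [:: true; false], b <- [:: true; false]]].

Definition weight (p : quad) : bool := p.1.1.1 (+) p.1.1.2 (+) p.1.2 (+) p.2.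
Definition subq (p r : quad) : bool :=
  [&& p.1.1.1 ==> r.1.1.1, p.1.1.2 ==> r.1.1.2, p.1.2 ==> r.1.2 & p.2 ==> r.2].
(** The possible parity vectors of a factorization: the generators being odd, the sum of the
    coefficients has the parity of the value, and odd coefficients occur only along arcs. *)
Definition parities (b : bool) (r : quad) : seq quad :=
  [seq p <- quads | (weight p == b) && subq p r].

Fixpoint every (Ls : seq (seq quad)) (P : pred (seq quad)) : bool :=
  if Ls is L :: Ls' then all (fun q => every Ls' (fun s => P (q :: s))) L else P [::].

Lemma everyP Ls P s : every Ls P -> all2 (fun q L => q \in L) s Ls -> P s.
Proof.
elim: Ls P s => [|L Ls IH] P [|q s] //= /allP PL /andP[qL sLs].
exact: (IH (fun s => P (q :: s))) (PL q qL) sLs.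
Qed.

Definition only (M : seq bitseq) (i j : nat) : bool := all (fun x => ent M i x ==> (x == j)) idx4.

Section Clue.
Variables (A B : seq bitseq) (arcs : seq (bool * nat * nat)) (q : seq quad).

Let kind k := (nth (true, 0, 0) arcs k).1.1.
Let src k := (nth (true, 0, 0) arcs k).1.2.
Let tgt k := (nth (true, 0, 0) arcs k).2.
Let val k := nth (unitq 4) q k.

(** Decidable forms of the hypotheses of the three averaging lemmas. The size tests keep the default
    values of [nth] out of play. *)
Definition clue_holds (c : clue) : bool :=
  match c with
  | Same k l => [&& k < size arcs, l < size arcs, ~~ kind k, ~~ kind l, src k != src l &
      xorq (val k) (val l) == xorq (unitq (src k)) (unitq (src l))]
  | Mixed k k' l l' => [&& k < size arcs, k' < size arcs, l < size arcs & l' < size arcs] &&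
      [&& kind k == kind k', kind l == ~~ kind k, kind l' == ~~ kind k,
      src k == tgt k', tgt k == src k', src k != src k', src l != src l' &
      xorq (xorq (val k) (val k')) (xorq (val l) (val l'))
      == xorq (xorq (unitq (src k)) (unitq (src k'))) (xorq (unitq (src l)) (unitq (src l')))]
  | Half k l a c => [&& k < size arcs, l < size arcs, a < size arcs & c < size arcs] &&
      [&& ~~ kind k, ~~ kind l, kind a, kind c, src a == src k, src c == src l &
      [&& only B (src k) (tgt k), only B (src l) (tgt l),
      all (fun x => ent A (src l) x ==> pred2 (tgt l) (tgt k) x) idx4,
      tgt a != tgt l, tgt a != tgt k, val k == unitq (tgt k), val l == unitq (tgt l) &
      xorq (val a) (val c) == xorq (unitq (tgt l)) (unitq (tgt k))]]
  end.

End Clue.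

Definition refuted (r : seq (seq nat) * seq (bool * nat * nat) * seq clue) : bool :=
  let: (adj, arcs, clues) := r in let A := mat_of_adj adj in let B := comat A in
  all (fun x => ent (if x.1.1 then A else B) x.1.2 x.2) arcs &&
  every [seq parities (~~ x.1.1) (mkquad (ent (if x.1.1 then A else B) x.1.2)) | x <- arcs]
        (fun q => has (clue_holds A B arcs q) clues).

(** By evaluation: whatever parities the factorizations along the listed arcs have, some clue
    applies. *)
Lemma refutations_valid : all refuted refutations.
Proof. by lazy. Qed.

(** * The digraph of an almost symmetric semigroup with odd generators *)

Section Compatible.
Variables (n : nat -> nat) (S : pred nat) (f g : nat).
Hypothesis SP : forall x, S x <-> exists v, x = comb n v.
Hypothesis n_odd : forall i, i < 4 -> odd (n i).
Hypothesis n_irr : forall i j s, i < 4 -> j < 4 -> S s -> n i = n j + s -> i = j.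
Hypotheses (f_odd : odd f) (g_even : ~~ odd g).
Hypotheses (f_gap : ~~ S f) (g_gap : ~~ S g) (fg_gap : ~~ S (f + g)).
Hypothesis f_pseudo : forall s, S s -> 0 < s -> S (f + s).
Hypothesis g_pseudo : forall s, S s -> 0 < s -> S (g + s).
Hypothesis conductor : forall x, f + g < x -> S x.
Hypothesis dual : forall x, x <= f + g -> S x \/ S (f + g - x) \/ x = f \/ x = g.

Let gap (b : bool) := if b then f else g.

Lemma n_gt0 i : i < 4 -> 0 < n i. Proof. by move/n_odd/odd_gt0. Qed.

Lemma neq_fg : f <> g. Proof. by move=> E; move: g_even; rewrite -E f_odd. Qed.

Lemma S_gen i : i < 4 -> S (n i).
Proof. by move=> lti; apply/SP; exists (delta i); rewrite comb_delta. Qed.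

Lemma arrow_irr b i : arrow n S (gap b) i i = false.
Proof. by rewrite /arrow leq_addl addnK; case: b; apply/negbTE. Qed.

(** The numbers [f + n j - n i] and [g + n i - n j] add up to the gap [f + g], so they are not both
    in [S]. If neither is, duality makes the first one [f], whence [n i = n j], or [g], which has
    the wrong parity. If one is negative, the other exceeds [f + g]. *)
Lemma arrow_dual i j : i < 4 -> j < 4 ->
  arrow n S g i j = (i != j) && ~~ arrow n S f j i.
Proof.
move=> lti ltj; have [->|ne] := eqVneq i j; first exact: (arrow_irr false).
rewrite /arrow /=; have [le1|gt1] := leqP (n j) (g + n i); last first.
  have le2 : n i <= f + n j by lia.
  by rewrite le2 /= conductor //; lia.
have [le2|gt2] := leqP (n i) (f + n j); last by rewrite conductor //; lia.
rewrite /=; case Sx: (S (f + n j - n i)) => /=.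
  apply/negbTE; apply: contra fg_gap => Sy.
  have -> : f + g = (f + n j - n i) + (g + n i - n j) by lia.
  by case/SP: Sx Sy => u -> /SP[v ->]; rewrite -combD; apply: S_comb.
have [|S1|[Sy|[E|E]]] := @dual (f + n j - n i).
- by lia.
- by rewrite S1 in Sx.
- by move: Sy; congr S; lia.
- by case/eqP: ne; apply: (@n_irr i j 0) => //; [apply/SP; exists (fun _ => 0) | lia].
- by have := n_odd lti; have := n_odd ltj; lia.
Qed.

Let A := mat (arrow n S f).
Let B := mat (arrow n S g).

Lemma comat_arrow : comat A = B.
Proof. by apply: eq_mat => i j lti ltj; rewrite arrow_dual // ent_mat lti ltj. Qed.

Lemma fac_exists b i : i < 4 -> exists v, fac n (gap b) i v.
Proof.
move=> lti; have /SP[v Ev] : S (gap b + n i).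
  by case: b; [apply: f_pseudo | apply: g_pseudo]; rewrite ?S_gen ?n_gt0.
by exists v.
Qed.

Lemma par_fac b i v : i < 4 -> fac n (gap b) i v ->
  par v \in parities (~~ b) (mkquad (ent (if b then A else B) i)).
Proof.
move=> lti Fv; have sup x : x < 4 -> odd (v x) ==> ent (if b then A else B) i x.
  move=> ltx; apply/implyP => /odd_gt0/(fac_arrow SP ltx Fv).
  by case: b {Fv} => /= arr; rewrite ent_mat lti ltx arr.
have odd_comb : odd (comb n v) = weight (par v).
  by rewrite /comb !oddD !oddM !n_odd // !andbT.
rewrite mem_filter /subq /= !sup // andbT; apply/andP; split; last first.
  by move: (par v) => [[[[] []] []] []].
by rewrite -odd_comb Fv oddD n_odd //; case: b {Fv sup} => /=; rewrite ?f_odd ?(negbTE g_even).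
Qed.

Lemma row_has b : all (has id) (if b then A else B).
Proof.
have nonempty i : i < 4 -> has id [seq arrow n S (gap b) i j | j <- idx4].
  move=> lti; have [v Fv] := fac_exists b lti; rewrite has_map.
  have [x ltx vx] : exists2 x, x < 4 & 0 < v x.
    have := n_gt0 lti; move: Fv; rewrite /fac /comb.
    case: (posnP (v 0)) => [->|]; last by exists 0.
    case: (posnP (v 1)) => [->|]; last by exists 1.
    case: (posnP (v 2)) => [->|]; last by exists 2.
    case: (posnP (v 3)) => [->|]; last by exists 3.
    by lia.
  apply/hasP; exists x; last exact: fac_arrow ltx Fv vx.
  by rewrite mem_idx4.
by case: b nonempty => nonempty; apply/allP => r /mapP[i i4 ->]; apply: nonempty;
  rewrite mem_idx4 in i4.
Qed.

Definition single_row (b : bool) (i j : nat) : Prop := supported n S (gap b) i (pred1 j).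

Lemma count1_row b i : i < 4 -> count id [seq arrow n S (gap b) i j | j <- idx4] = 1 ->
  exists2 j, j < 4 & single_row b i j /\ [seq arrow n S (gap b) i j | j <- idx4] = [seq x == j | x <- idx4].
Proof.
move=> lti /=; set a0 := arrow _ _ _ _ 0; set a1 := arrow _ _ _ _ 1.
set a2 := arrow _ _ _ _ 2; set a3 := arrow _ _ _ _ 3.
have wit j : a0 = (0 == j) -> a1 = (1 == j) -> a2 = (2 == j) -> a3 = (3 == j) -> single_row b i j.
  by move=> e0 e1 e2 e3; apply: lt4_ind; rewrite -/a0 -/a1 -/a2 -/a3 ?e0 ?e1 ?e2 ?e3 /= eq_sym.
move: a0 a1 a2 a3 wit => [] [] [] [] // wit _.
- by exists 0 => //; split=> //; apply: wit.
- by exists 1 => //; split=> //; apply: wit.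
- by exists 2 => //; split=> //; apply: wit.
- by exists 3 => //; split=> //; apply: wit.
Qed.

Lemma single_le b b' i k j u v : i < 4 -> k < 4 -> single_row b i j -> single_row b' k j ->
  fac n (gap b) i u -> fac n (gap b') k v -> u j <= v j -> forall x, x < 4 -> u x <= v x.
Proof.
move=> lti ltk si sk Fu Fv le x ltx; have [->//|ne] := eqVneq x j.
by rewrite (fac_supported SP si Fu ltx).
Qed.

(** Both rows are multiples of [n j], hence comparable, and their difference writes one generator as
    the other plus an element of [S]. *)
Lemma single_inj b i k j : i < 4 -> k < 4 -> single_row b i j -> single_row b k j -> i = k.
Proof.
move=> lti ltk si sk; have [u Fu] := fac_exists b lti; have [v Fv] := fac_exists b ltk.
have [le|/ltnW le] := leqP (u j) (v j).
  by have [s Ss Es] := fac_le_irr SP Fu Fv (single_le lti ltk si sk Fu Fv le); apply/esym/(n_irr _ _ Ss Es).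
by have [s Ss Es] := fac_le_irr SP Fv Fu (single_le ltk lti sk si Fv Fu le); apply/(n_irr _ _ Ss Es).
Qed.

(** Multiples of the same [n j] are comparable, against [fac_not_le]. *)
Lemma single_compat i j : i < 4 -> single_row true i j -> single_row false i j -> False.
Proof.
move=> lti sf sg; have [u Fu] := fac_exists true lti; have [v Fv] := fac_exists false lti.
have [le|/ltnW le] := leqP (u j) (v j).
  have := fac_not_le SP g_gap (nesym neq_fg) f_pseudo Fv Fu.
  by apply; apply: single_le sf sg Fu Fv le.
have := fac_not_le SP f_gap neq_fg g_pseudo Fu Fv.
by apply; apply: single_le sg sf Fv Fu le.
Qed.

Lemma single_rows_uniq b : uniq [seq r <- if b then A else B | count id r == 1].
Proof.
have -> : (if b then A else B) = [seq [seq arrow n S (gap b) i j | j <- idx4] | i <- idx4] by case: b.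
rewrite filter_map map_inj_in_uniq ?filter_uniq // => i k.
rewrite !mem_filter !mem_idx4 => /andP[/eqP ci lti] /andP[/eqP ck ltk] E.
have [j ltj [si Ei]] := count1_row lti ci; have [j' ltj' [sk Ek]] := count1_row ltk ck.
move: E; rewrite Ei Ek => E; suff Ej : j = j' by apply: (@single_inj b i k j); rewrite // Ej.
move: j ltj j' ltj' E {si Ei sk Ek}; apply: lt4_ind; apply: lt4_ind; by [].
Qed.

Lemma rows_differ i : i < 4 ->
  ~~ ((count id [seq arrow n S f i j | j <- idx4] == 1)
      && ([seq arrow n S f i j | j <- idx4] == [seq arrow n S g i j | j <- idx4])).
Proof.
move=> lti; apply/negP => /andP[/eqP c1 /eqP E].
have [j ltj [si Ei]] := @count1_row true i lti c1.
apply: (single_compat lti si) => x ltx; apply: contraTT; rewrite /=.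
have := congr1 (fun r => nth false r x) (etrans (esym E) Ei).
by move: x ltx; apply: lt4_ind => /= -> .
Qed.

Lemma graph_ok_arrow : graph_ok A.
Proof.
rewrite /graph_ok comat_arrow; apply/and5P; split.
- exact: (row_has true).
- exact: (row_has false).
- exact: (single_rows_uniq true).
- exact: (single_rows_uniq false).
- by apply/and5P; split=> //; [apply: (@rows_differ 0) | apply: (@rows_differ 1) |
    apply: (@rows_differ 2) | apply: (@rows_differ 3)].
Qed.

Lemma four_cycle_or_other :
  has (fun p => relabel A p \in four_cycle :: [seq mat_of_adj r.1.1 | r <- refutations])
      (permutations idx4).
Proof.
pose e := [:: arrow n S f 0 1; arrow n S f 0 2; arrow n S f 0 3; arrow n S f 1 0; arrow n S f 1 2;
  arrow n S f 1 3; arrow n S f 2 0; arrow n S f 2 1; arrow n S f 2 3; arrow n S f 3 0;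
  arrow n S f 3 1; arrow n S f 3 2].
have EA : A = mat_of_bits e by rewrite /A /mat /= !(arrow_irr true).
have : graph_ok (mat_of_bits e) ==> has (fun p => relabel (mat_of_bits e) p \in
    four_cycle :: [seq mat_of_adj r.1.1 | r <- refutations]) (permutations idx4).
  exact: all_bitsP graph_classification (erefl : size e = 12).
by rewrite -EA graph_ok_arrow.
Qed.

Definition realized (x : bool * nat * nat) (q : quad) : Prop :=
  exists2 v, fac n (gap x.1.1) x.1.2 v /\ 0 < v x.2 & par v = q.

Lemma realize_arcs arcs :
  all (fun x => ent (if x.1.1 then A else B) x.1.2 x.2) arcs ->
  exists2 q, all2 (fun p L => p \in L) q
      [seq parities (~~ x.1.1) (mkquad (ent (if x.1.1 then A else B) x.1.2)) | x <- arcs] &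
    forall k, k < size arcs -> realized (nth (true, 0, 0) arcs k) (nth (unitq 4) q k).
Proof.
elim: arcs => [|[[b i] j] arcs IH] /=; first by exists [::].
case/andP=> arr /IH[q mq rq].
have [lti ltj arr'] : [/\ i < 4, j < 4 & arrow n S (gap b) i j].
  by case: b arr => /=; rewrite ent_mat => /and3P[].
have [v Fv vj] := arrow_fac SP ltj arr'.
exists (par v :: q); first by rewrite /= mq par_fac.
by case=> [|k] lek; [exists v | apply: rq].
Qed.

Section Clues.
Variables (arcs : seq (bool * nat * nat)) (q : seq quad).
Hypothesis valid : all (fun x => ent (if x.1.1 then A else B) x.1.2 x.2) arcs.
Hypothesis real : forall k, k < size arcs -> realized (nth (true, 0, 0) arcs k) (nth (unitq 4) q k).

Lemma arc_real k : k < size arcs ->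
  let x := nth (true, 0, 0) arcs k in
  [/\ x.1.2 < 4, x.2 < 4 &
      exists v, [/\ fac n (gap x.1.1) x.1.2 v, 0 < v x.2 & par v = nth (unitq 4) q k]].
Proof.
move=> ltk x; have [v [Fv vx] pv] := real ltk.
have /(allP valid) arr : x \in arcs by apply: mem_nth.
have [-> ->] : x.1.2 < 4 /\ x.2 < 4.
  by move: arr; case: (x.1.1); rewrite ent_mat => /and3P[-> ->].
by split=> //; exists v.
Qed.

Lemma only_supported i j : i < 4 -> only B i j -> supported n S g i (pred1 j).
Proof.
move=> lti /allP on x ltx arr; have /on : x \in idx4 by rewrite mem_idx4.
by rewrite ent_mat lti ltx arr.
Qed.

(** [Same] would put [g] in [S], [Mixed] would put [f + g] there, and [Half] contradicts
    [half_relation]. *)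
Lemma clue_sound c : ~~ clue_holds A B arcs q c.
Proof.
case: c => [k l|k k' l l'|k l a c]; apply/negP; rewrite /clue_holds.
- case/and5P=> /arc_real[i4 _ [u [Fu _ <-]]] /arc_real[j4 _ [v [Fv _ <-]]].
  move: Fu Fv => + + /negbTE kk /negbTE kl /andP[/eqP ne /eqP E]; rewrite kk kl => Fu Fv.
  by move/negP: g_gap; apply; apply: (average_same SP i4 j4 ne Fu Fv E).
- case/andP=> /and4P[/arc_real[i4 _ [u [Fu uj <-]]] /arc_real[j4 _ [u' [Fu' u'i <-]]]
    /arc_real[p4 _ [v [Fv _ <-]]] /arc_real[r4 _ [v' [Fv' _ <-]]]].
  case/and5P=> /eqP kk /eqP kl /eqP kl' /eqP E1 /and4P[/eqP E2 /eqP neij /eqP nepr /eqP E].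
  move/negP: fg_gap; apply; move: Fu uj Fu' u'i Fv Fv'.
  rewrite -kk kl kl' E2 -E1 => Fu uj Fu' u'i Fv Fv'.
  have := average_mixed SP i4 j4 p4 r4 neij nepr Fu uj Fu' u'i Fv Fv' E.
  by rewrite /gap; case: (_.1.1) => //=; rewrite addnC.
- case/andP=> /and4P[/arc_real[i4 _ [u [Fu uj pu]]] /arc_real[j4 _ [u' [Fu' u'i pu']]]
    /arc_real[p4 r4 [v [Fv vr pv]]] /arc_real[p4' _ [v' [Fv' _ pv']]]].
  case/and5P=> /negbTE kk /negbTE kl ka kc /and3P[/eqP E1 /eqP E2].
  case/and5P=> on1 on2 /allP on3 /eqP ne1 /and4P[/eqP ne2 /eqP pk /eqP pl /eqP E].
  move: Fu Fu' Fv Fv'; rewrite kk kl ka kc E1 E2 => Fu Fu' Fv Fv'.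
  have on3' : supported n S f (nth (true, 0, 0) arcs l).1.2
      (pred2 (nth (true, 0, 0) arcs l).2 (nth (true, 0, 0) arcs k).2).
    move=> x ltx arr; have /on3 : x \in idx4 by rewrite mem_idx4.
    by rewrite ent_mat j4 ltx arr.
  apply: (half_relation SP f_gap neq_fg g_pseudo i4 j4 r4 ne1 ne2
    (only_supported i4 on1) (only_supported j4 on2) on3' Fu _ Fu' _ Fv vr Fv'); congruence.
Qed.

Lemma clues_sound cs : ~~ has (clue_holds A B arcs q) cs.
Proof. by elim: cs => //= c cs IH; rewrite negb_or clue_sound. Qed.

End Clues.

(** Factorizations along the listed arcs exist and have admissible parities, so a clue would
    hold. *)
Lemma arrow_not_refuted : all (fun r => A != mat_of_adj r.1.1) refutations.
Proof.
apply: sub_all refutations_valid => -[[adj arcs] clues] /= /andP[valid ev]; apply/eqP => EA.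
rewrite -EA comat_arrow in valid ev.
have [q mq rq] := realize_arcs valid.
by have := everyP ev mq; apply/negP; apply: clues_sound.
Qed.

End Compatible.

(** * The four-cycle *)

Lemma comb_sum n v : comb n v = \sum_(x <- idx4) v x * n x.
Proof. by rewrite !big_cons big_nil /comb; lia. Qed.

Lemma perm4_nth p : p \in permutations idx4 -> [seq nth 0 p i | i <- idx4] = p.
Proof.
rewrite mem_permutations => pp; have sz : size p = 4 by rewrite (perm_size pp).
by case: p sz {pp} => [|a [|b [|c [|d []]]]].
Qed.

Lemma comb_relabel n p v : p \in permutations idx4 ->
  comb (fun i => n (nth 0 p i)) (fun i => v (nth 0 p i)) = comb n v.
Proof.
move=> pp; rewrite !comb_sum -(big_map (nth 0 p) predT (fun x => v x * n x)) perm4_nth //.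
by apply: perm_big; rewrite -mem_permutations.
Qed.

(** Subtracting the two rows of [g] and inserting the relations of [f] gives [m3 * n3 + (x2 - y2 -
    1) * n2 = (m1 - x1 - 1) * n1 + y3 * n3]. The support conditions then make all three differences
    vanish. *)
Lemma cycle_rows (n0 n1 n2 n3 f g m1 m2 m3 x1 x2 y2 y3 : nat) :
  0 < n1 -> f + n0 = m1 * n1 -> f + n1 = m2 * n2 -> f + n2 = m3 * n3 ->
  (forall c0 c1 c2 c3, f + n0 = c0 * n0 + c1 * n1 + c2 * n2 + c3 * n3 -> [/\ c0 = 0, c2 = 0 & c3 = 0]) ->
  (forall c0 c1 c2 c3, g + n0 = c0 * n0 + c1 * n1 + c2 * n2 + c3 * n3 -> c3 = 0) ->
  (forall c1 c2 c3, g <> f + c1 * n1 + c2 * n2 + c3 * n3) ->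
  g + n0 = x1 * n1 + x2 * n2 -> g + n1 = y2 * n2 + y3 * n3 ->
  [/\ x1.+1 = m1, x2 = y2.+1 & y3 = m3].
Proof.
move=> n1_gt0 e0 e1 e2 uf ug ngf ex ey.
have uniq1 k c0 c2 c3 : k <= m1 -> k * n1 = c0 * n0 + c2 * n2 + c3 * n3 -> [/\ c0 = 0, c2 = 0 & c3 = 0].
  move=> lek E; apply: (uf c0 (m1 - k)); rewrite e0 -{1}(subnK lek); lia.
have lt_x1 : x1 < m1.
  rewrite ltnNge; apply/negP => le; have [c Ec] : exists c, x1 = m1 + c by exists (x1 - m1); lia.
  by apply: (ngf c x2 0); move: ex; rewrite Ec; lia.
(* Otherwise [x1.+1 <= m1] copies of [n1] equal a combination containing [n0], against [uniq1]. *)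
have lt_y2 : y2 < x2.
  rewrite ltnNge; apply/negP => le; have [c Ec] : exists c, y2 = x2 + c by exists (y2 - x2); lia.
  by have [||] := @uniq1 x1.+1 1 c y3 => //; move: ex ey; rewrite Ec; lia.
have [t Et] : exists t, x2 = y2 + t.+1 by exists (x2 - y2).-1; lia.
have [d Ed] : exists d, m1 = x1 + d.+1 by exists (m1 - x1).-1; lia.
(* If [y3 > m3], the surplus [t * n2] trades for a combination containing [n3], so [g + n0] would
   use [n3]. *)
have [le|gt] := leqP y3 m3; last first.
  have [c Ec] : exists c, y3 = m3 + c.+1 by exists (y3 - m3).-1; lia.
  have : c.+1 = 0; last by [].
  by apply: (ug 0 (x1 + d) y2.+1); move: e0 ex ey; rewrite Et Ed Ec; lia.
have [c Ec] : exists c, m3 = y3 + c by exists (m3 - y3); lia.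
have [||_ t0 c0] := @uniq1 d 0 t c; first by lia.
  by move: e0 e2 ex ey; rewrite Et Ed Ec; lia.
have : d * n1 = 0 by move: e0 e2 ex ey; rewrite Et Ed Ec t0 c0; lia.
move/eqP; rewrite muln_eq0 -[n1 == 0]leqn0 leqNgt n1_gt0 orbF => /eqP d0.
by split; lia.
Qed.

(** Successor on the cycle; the default 0 keeps [nxt_lt] unconditional. *)
Definition nxt (i : nat) : nat := nth 0 [:: 1; 2; 3; 0] i.

Lemma nxt_lt i : nxt i < 4.
Proof. by case: i => [|[|[|[|i]]]] //; rewrite /nxt nth_default. Qed.

Section FourCycle.
Variables (n : nat -> nat) (S : pred nat) (f g : nat).
Hypothesis SP : forall x, S x <-> exists v, x = comb n v.
Hypothesis n_odd : forall i, i < 4 -> odd (n i).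
Hypothesis n_irr : forall i j s, i < 4 -> j < 4 -> S s -> n i = n j + s -> i = j.
Hypotheses (f_odd : odd f) (g_even : ~~ odd g).
Hypotheses (f_gap : ~~ S f) (g_gap : ~~ S g) (fg_gap : ~~ S (f + g)).
Hypothesis f_pseudo : forall s, S s -> 0 < s -> S (f + s).
Hypothesis g_pseudo : forall s, S s -> 0 < s -> S (g + s).
Hypothesis conductor : forall x, f + g < x -> S x.
Hypothesis dual : forall x, x <= f + g -> S x \/ S (f + g - x) \/ x = f \/ x = g.
Hypothesis cycle : mat (arrow n S f) = four_cycle.

Let vec4 (c0 c1 c2 c3 x : nat) : nat := nth 0 [:: c0; c1; c2; c3] x.

Lemma arrow_cycle i j : i < 4 -> j < 4 -> arrow n S f i j = (j == nxt i).
Proof.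
move=> lti ltj; have := ent_mat (arrow n S f) i j; rewrite cycle lti ltj /= => <-.
by move: i lti j ltj; apply: lt4_ind; apply: lt4_ind.
Qed.

Lemma coarrow_cycle i j : i < 4 -> j < 4 -> arrow n S g i j = (i != j) && (i != nxt j).
Proof.
move=> lti ltj; rewrite (@arrow_dual n S f g) //; congr (_ && ~~ _).
by rewrite arrow_cycle.
Qed.

Lemma fac_f_cycle i v x : i < 4 -> x < 4 -> x != nxt i -> fac n f i v -> v x = 0.
Proof.
move=> lti ltx ne Fv; apply/eqP; rewrite -leqn0 leqNgt; apply: contra ne => vx.
by rewrite -arrow_cycle // (fac_arrow SP ltx Fv vx).
Qed.

Lemma fac_g_cycle i v x : i < 4 -> x < 4 -> (i == x) || (i == nxt x) -> fac n g i v -> v x = 0.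
Proof.
move=> lti ltx eqx Fv; apply/eqP; rewrite -leqn0 leqNgt; apply/negP => vx.
by have := fac_arrow SP ltx Fv vx; rewrite coarrow_cycle // -negb_or eqx.
Qed.

(** Only one arc leaves [i]; the multiplier is even because [f + n i] is even and the generators are
    odd. *)
Lemma f_row i : i < 4 -> exists2 m, f + n i = m * n (nxt i) & ~~ odd m /\ 0 < m.
Proof.
move=> lti; have [v Fv] : exists v, fac n f i v by apply: (@fac_exists n S f g _ _ _ _ true).
have E : f + n i = v (nxt i) * n (nxt i).
  rewrite -Fv /comb; have z x := @fac_f_cycle i v x lti.
  move: i lti Fv z; apply: lt4_ind => Fv z; rewrite /nxt /=.
  - by rewrite (z 0) // (z 2) // (z 3) //; lia.
  - by rewrite (z 0) // (z 1) // (z 3) //; lia.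
  - by rewrite (z 0) // (z 1) // (z 2) //; lia.
  - by rewrite (z 1) // (z 2) // (z 3) //; lia.
exists (v (nxt i)) => //.
have : ~~ odd (f + n i) by rewrite oddD f_odd n_odd.
rewrite E oddM n_odd ?nxt_lt // andbT => -> ; split=> //.
by rewrite lt0n; apply/eqP => z; move: E (n_odd lti); rewrite z; lia.
Qed.

Lemma g_not_above s : S s -> g <> f + s.
Proof.
move=> Ss E; have [s0|s_gt0] := posnP s; first by lia.
by move: g_gap; rewrite E f_pseudo.
Qed.

(** The reversed non-arcs of the cycle lead from [i] to its next two successors. *)
Lemma g_row i v : i < 4 -> fac n g i v ->
  g + n i = v (nxt i) * n (nxt i) + v (nxt (nxt i)) * n (nxt (nxt i)).
Proof.
move=> lti Fv; rewrite -Fv /comb; have z x := @fac_g_cycle i v x lti.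
move: i lti Fv z; apply: lt4_ind => Fv z; rewrite /nxt /=.
- by rewrite (z 0) // (z 3) //; lia.
- by rewrite (z 0) // (z 1) //; lia.
- by rewrite (z 1) // (z 2) //; lia.
- by rewrite (z 2) // (z 3) //; lia.
Qed.

Lemma S_cycle i x : i < 4 -> S x <-> exists c1 c2 c3 c4,
  x = c1 * n i + c2 * n (nxt i) + c3 * n (nxt (nxt i)) + c4 * n (nxt (nxt (nxt i))).
Proof.
move=> lti; rewrite SP; split=> [[v ->] | [c1 [c2 [c3 [c4 ->]]]]].
  exists (v i), (v (nxt i)), (v (nxt (nxt i))), (v (nxt (nxt (nxt i)))).
  by move: i lti; rewrite /comb /nxt; apply: lt4_ind => /=; lia.
move: i lti; rewrite /comb /nxt; apply: lt4_ind => /=.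
- by exists (vec4 c1 c2 c3 c4).
- by exists (vec4 c4 c1 c2 c3); rewrite /vec4 /=; lia.
- by exists (vec4 c3 c4 c1 c2); rewrite /vec4 /=; lia.
- by exists (vec4 c2 c3 c4 c1); rewrite /vec4 /=; lia.
Qed.

Lemma f_row_support i c0 c1 c2 c3 : i < 4 ->
  f + n i = c0 * n i + c1 * n (nxt i) + c2 * n (nxt (nxt i)) + c3 * n (nxt (nxt (nxt i))) ->
  [/\ c0 = 0, c2 = 0 & c3 = 0].
Proof.
move=> lti E; have z x v := @fac_f_cycle i v x lti.
move: i lti E z; rewrite /nxt; apply: lt4_ind => /= E z.
- have F : fac n f 0 (vec4 c0 c1 c2 c3) by rewrite /fac /comb /vec4 /=; lia.
  by split; [have := z 0 _ _ _ F | have := z 2 _ _ _ F | have := z 3 _ _ _ F]; apply.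
- have F : fac n f 1 (vec4 c3 c0 c1 c2) by rewrite /fac /comb /vec4 /=; lia.
  by split; [have := z 1 _ _ _ F | have := z 3 _ _ _ F | have := z 0 _ _ _ F]; apply.
- have F : fac n f 2 (vec4 c2 c3 c0 c1) by rewrite /fac /comb /vec4 /=; lia.
  by split; [have := z 2 _ _ _ F | have := z 0 _ _ _ F | have := z 1 _ _ _ F]; apply.
- have F : fac n f 3 (vec4 c1 c2 c3 c0) by rewrite /fac /comb /vec4 /=; lia.
  by split; [have := z 3 _ _ _ F | have := z 1 _ _ _ F | have := z 2 _ _ _ F]; apply.
Qed.

(** Exchanging [k] of the [m] copies of [n (nxt i)] gives another factorization of [f + n i]. *)
Lemma f_indep i k c1 c2 c3 m : i < 4 -> f + n i = m * n (nxt i) -> k <= m ->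
  k * n (nxt i) = c1 * n i + c2 * n (nxt (nxt i)) + c3 * n (nxt (nxt (nxt i))) ->
  [/\ c1 = 0, c2 = 0 & c3 = 0].
Proof.
move=> lti E lek Ek; apply: (@f_row_support i c1 (m - k) c2 c3 lti).
by rewrite E -{1}(subnK lek) mulnDl Ek; lia.
Qed.

Lemma g_row_support i c0 c1 c2 c3 : i < 4 ->
  g + n i = c0 * n i + c1 * n (nxt i) + c2 * n (nxt (nxt i)) + c3 * n (nxt (nxt (nxt i))) ->
  c3 = 0.
Proof.
move=> lti E; have z x v := @fac_g_cycle i v x lti.
move: i lti E z; rewrite /nxt; apply: lt4_ind => /= E z.
- have F : fac n g 0 (vec4 c0 c1 c2 c3) by rewrite /fac /comb /vec4 /=; lia.
  by have := z 3 _ _ _ F; apply.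
- have F : fac n g 1 (vec4 c3 c0 c1 c2) by rewrite /fac /comb /vec4 /=; lia.
  by have := z 0 _ _ _ F; apply.
- have F : fac n g 2 (vec4 c2 c3 c0 c1) by rewrite /fac /comb /vec4 /=; lia.
  by have := z 1 _ _ _ F; apply.
- have F : fac n g 3 (vec4 c1 c2 c3 c0) by rewrite /fac /comb /vec4 /=; lia.
  by have := z 2 _ _ _ F; apply.
Qed.

Lemma g_rows i v w m1 m2 m3 : i < 4 -> fac n g i v -> fac n g (nxt i) w ->
  f + n i = m1 * n (nxt i) -> f + n (nxt i) = m2 * n (nxt (nxt i)) ->
  f + n (nxt (nxt i)) = m3 * n (nxt (nxt (nxt i))) ->
  [/\ (v (nxt i)).+1 = m1, v (nxt (nxt i)) = (w (nxt (nxt i))).+1 & w (nxt (nxt (nxt i))) = m3].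
Proof.
move=> lti Fv Fw e0 e1 e2.
apply: (cycle_rows _ e0 e1 e2) (g_row lti Fv) (g_row (nxt_lt i) Fw).
- exact: odd_gt0 (n_odd (nxt_lt i)).
- by move=> c0 c1 c2 c3; apply: f_row_support.
- by move=> c0 c1 c2 c3; apply: g_row_support.
- move=> c1 c2 c3 E; apply: (@g_not_above (c1 * n (nxt i) + c2 * n (nxt (nxt i)) + c3 * n (nxt (nxt (nxt i))))).
    by apply/(S_cycle _ lti); exists 0, c1, c2, c3.
  by lia.
Qed.

(** By [g_rows], [g + n 0 = (m1 - 1) * n 1 + m2 * n 2], which is [(f + n 0 - n 1) + (f + n 1)]. *)
Lemma g_double : g = f + f.
Proof.
have facg i (lti : i < 4) : exists v, fac n g i v by apply: (@fac_exists n S f g _ _ _ _ false).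
have [v Fv] := @facg 0 isT; have [w Fw] := @facg 1 isT; have [u Fu] := @facg 2 isT.
have [m1 e0 _] := @f_row 0 isT; have [m2 e1 _] := @f_row 1 isT.
have [m3 e2 _] := @f_row 2 isT; have [m0 e3 _] := @f_row 3 isT.
have [v1 v2 _] := @g_rows 0 v w m1 m2 m3 isT Fv Fw e0 e1 e2.
have [w2 _ _] := @g_rows 1 w u m2 m3 m0 isT Fw Fu e1 e2 e3.
have := @g_row 0 v isT Fv; move: v1 v2 w2 e0 e1; rewrite /nxt /= => v1 v2 w2.
by rewrite v2 w2 -v1; lia.
Qed.

(** The box with [n i] in first position has [n i] elements; [2f = g] and [3f = f + g] are gaps. *)
Lemma cycle_gen i m1 m2 m3 m0 : i < 4 -> f + n i = m1 * n (nxt i) ->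
  f + n (nxt i) = m2 * n (nxt (nxt i)) -> f + n (nxt (nxt i)) = m3 * n (nxt (nxt (nxt i))) ->
  f + n (nxt (nxt (nxt i))) = m0 * n i -> 1 < m1 -> 1 < m2 -> 1 < m3 -> 1 < m0 ->
  n i = m1 * m2 * m3.+1 + m1.+1.
Proof.
move=> lti e1 e2 e3 e0 h1 h2 h3 h0.
have nxt4 : nxt (nxt (nxt (nxt i))) = i by move: i lti {e1 e2 e3 e0}; apply: lt4_ind.
rewrite -(size_box (n (nxt i)) (n (nxt (nxt i))) (n (nxt (nxt (nxt i))))).
apply/esym; apply: (@size_box_n1 (n i) (n (nxt i)) (n (nxt (nxt i))) (n (nxt (nxt (nxt i)))) f m0 m1 m2 m3 S) => //.
- by move=> x; apply: S_cycle.
- exact: odd_gt0 (n_odd lti).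
- by exists (f + g).+1.
- by rewrite -g_double.
- by rewrite -addnA -g_double.
- by move=> k c1 c3 c4 lek E; have [] := f_indep lti e1 lek E.
- by move=> k c1 c2 c4 lek E; have [|? ? ?] := @f_indep (nxt i) k c2 c4 c1 m2 (nxt_lt _) e2 lek; rewrite ?nxt4; lia.
- by move=> k c1 c2 c3 lek E; have [|? ? ?] := @f_indep (nxt (nxt i)) k c3 c1 c2 m3 (nxt_lt _) e3 lek; rewrite ?nxt4; lia.
Qed.

Lemma four_cycle_gens4 : exists a1 a2 a3 a4 : nat,
  [/\ odd a1, odd a2, odd a3 & odd a4] /\ [/\ 1 < a1, 1 < a2, 1 < a3 & 1 < a4] /\
  forall x, S x = in_gen (gens4 a1 a2 a3 a4) x.
Proof.
have [m1 e0 [o1 p1]] := @f_row 0 isT; have [m2 e1 [o2 p2]] := @f_row 1 isT.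
have [m3 e2 [o3 p3]] := @f_row 2 isT; have [m0 e3 [o0 p0]] := @f_row 3 isT.
have {p0 p1 p2 p3} [p0 p1 p2 p3] : [/\ 1 < m0, 1 < m1, 1 < m2 & 1 < m3] by split; lia.
have n0 := @cycle_gen 0 m1 m2 m3 m0 isT e0 e1 e2 e3 p1 p2 p3 p0.
have n1 := @cycle_gen 1 m2 m3 m0 m1 isT e1 e2 e3 e0 p2 p3 p0 p1.
have n2 := @cycle_gen 2 m3 m0 m1 m2 isT e2 e3 e0 e1 p3 p0 p1 p2.
have n3 := @cycle_gen 3 m0 m1 m2 m3 isT e3 e0 e1 e2 p0 p1 p2 p3.
(* The multiplier of the relation leading to generator number [i] is [a_i - 1], so [m0], which leads
   back to the first generator, gives [a1]. *)
exists m0.+1, m1.+1, m2.+1, m3.+1; split; first by [].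
split; first by split; lia.
move=> x; apply/idP/idP => [/(S_cycle _ (isT : 0 < 4)) | /in_gen4P].
  case=> c1 [c2 [c3 [c4 ->]]]; apply/in_gen4P; exists c1, c2, c3, c4.
  by rewrite /nxt /= n0 n1 n2 n3 !subn1.
case=> c1 [c2 [c3 [c4 ->]]]; apply/(S_cycle _ (isT : 0 < 4)); exists c1, c2, c3, c4.
by rewrite /nxt /= n0 n1 n2 n3 !subn1.
Qed.

End FourCycle.

(** * Almost symmetric semigroups of type three with odd generators *)

(** The generators are permuted until the digraph is literally a listed one; all but the four-cycle
    are refuted. *)
Lemma odd_almost_symmetric_gens4 (n : nat -> nat) (S : pred nat) (f g : nat) :
  (forall x, S x <-> exists v, x = comb n v) -> (forall i, i < 4 -> odd (n i)) ->
  (forall i j s, i < 4 -> j < 4 -> S s -> n i = n j + s -> i = j) ->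
  odd f -> ~~ odd g -> ~~ S f -> ~~ S g -> ~~ S (f + g) ->
  (forall s, S s -> 0 < s -> S (f + s)) -> (forall s, S s -> 0 < s -> S (g + s)) ->
  (forall x, f + g < x -> S x) ->
  (forall x, x <= f + g -> S x \/ S (f + g - x) \/ x = f \/ x = g) ->
  exists a1 a2 a3 a4 : nat,
    [/\ odd a1, odd a2, odd a3 & odd a4] /\ [/\ 1 < a1, 1 < a2, 1 < a3 & 1 < a4] /\
    forall x, S x = in_gen (gens4 a1 a2 a3 a4) x.
Proof.
move=> SP n_odd n_irr fo ge Sf Sg Sfg pf pg cond dual.
have /hasP[p pp] := four_cycle_or_other SP n_odd n_irr fo ge Sf Sg Sfg pf pg cond dual.
pose n' i := n (nth 0 p i).
have pq : perm_eq p idx4 by rewrite -mem_permutations.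
have sz : size p = 4 by rewrite (perm_size pq).
have p_lt i : i < 4 -> nth 0 p i < 4.
  by move=> lti; rewrite -mem_idx4 -(perm_mem pq) mem_nth ?sz.
have SP' x : S x <-> exists v, x = comb n' v.
  rewrite SP; split=> [[v ->]|[v ->]].
    by exists (fun i => v (nth 0 p i)); rewrite /n' comb_relabel.
  (* [index] inverts the permutation [p]. *)
  exists (fun x => v (index x p)).
  rewrite -(comb_relabel n (fun x => v (index x p)) pp); apply: eq_comb => i lti.
  by rewrite index_uniq ?sz // (perm_uniq pq).
have n_odd' i : i < 4 -> odd (n' i) by move=> lti; apply/n_odd/p_lt.
have n_irr' i j s : i < 4 -> j < 4 -> S s -> n' i = n' j + s -> i = j.
  move=> lti ltj Ss /(n_irr _ _ _ (p_lt i lti) (p_lt j ltj) Ss)/eqP.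
  by rewrite nth_uniq ?sz ?(perm_uniq pq) // => /eqP.
have -> : relabel (mat (arrow n S f)) p = mat (arrow n' S f).
  by apply: eq_mat => i j lti ltj; rewrite ent_mat !p_lt.
rewrite inE => /orP[/eqP cyc | ].
  exact: (four_cycle_gens4 SP' n_odd' n_irr' fo ge Sf Sg Sfg pf pg cond dual cyc).
have := arrow_not_refuted SP' n_odd' n_irr' fo ge Sf Sg Sfg pg cond dual.
by rewrite -(all_map _ (fun M => _ != M)) => /allP H /H; rewrite eqxx.
Qed.

(** Strong induction: a positive element splits inside [S] or is a minimal generator. *)
Lemma min_gen_comb (S : pred nat) (l : seq nat) :
  numerical_semigroup S -> (forall x, x \in l <-> min_gen S x) -> size l = 4 ->
  forall x, S x <-> exists v, x = comb (nth 0 l) v.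
Proof.
move=> [S0 [Sadd _]] lP sz x; split; last first.
  have SM k y : S y -> S (k * y).
    by move=> Sy; elim: k => [|k IH] //; rewrite mulSn Sadd.
  have Sl i : i < 4 -> S (nth 0 l i).
    by rewrite -sz => /(mem_nth 0)/lP[_ []].
  by case=> v ->; rewrite /comb !Sadd // SM // Sl.
elim/ltn_ind: x => x IH Sx; have [->|x_gt0] := posnP x; first by exists (fun _ => 0).
have [/hasP[a] | /hasPn irr] := boolP (has (fun a => S a && S (x - a)) (iota 1 x.-1)).
  rewrite mem_iota => lea /andP[Sa Sb].
  have [|u Eu] := IH a _ Sa; first by lia.
  have [|v Ev] := IH (x - a) _ Sb; first by lia.
  by exists (vadd u v); rewrite combD -Eu -Ev; lia.
have /lP/(nthP 0)[i] : min_gen S x.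
  split=> //; split=> // -[a [b [a0 [b0 [Sa [Sb E]]]]]].
  have /irr : a \in iota 1 x.-1 by rewrite mem_iota; lia.
  by rewrite Sa (_ : x - a = b) ?Sb //; lia.
by rewrite sz => lti <-; exists (delta i); rewrite comb_delta.
Qed.

(** Almost symmetry of type three leaves exactly two twin gaps, and the two pseudo-Frobenius numbers
    other than [F] are twin gaps, so they are all of them. *)
Lemma type3_duality (S : pred nat) : numerical_semigroup S -> almost_symmetric S -> sg_type S 3 ->
  exists f g, [/\ odd f, ~~ odd g, pseudo_frob S f & pseudo_frob S g] /\
    [/\ ~~ S (f + g), forall x, f + g < x -> S x &
        forall x, x <= f + g -> S x \/ S (f + g - x) \/ x = f \/ x = g].
Proof.
move=> [S0 [Sadd _]] [d [F [t [genusd [frobF [typet E]]]]]] type3.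
have t3 := card_is_inj typet type3.
have dE := card_is_inj genusd (genus_count frobF).
have twin2 : count (twin_gap S F) (iota 0 F.+1) = 2.
  by have := double_gap_count Sadd frobF; lia.
have [l [ul [lP sl]]] := type3.
have FPF : F \in l by apply/lP; split=> [|s Ss s0]; [case: frobF | apply: (proj2 frobF); lia].
have PF_twin x : x \in l -> x != F -> twin_gap S F x.
  move=> /lP[gx px] neF; rewrite /twin_gap gx; apply/negP => SFx.
  have le := gap_le frobF gx; move/negP: (proj1 frobF); apply.
  by rewrite -(subnKC le) px // subn_gt0 ltn_neqAle neF.
have [a [b [neab al bl]]] : exists a b, [/\ a != b, a \in rem F l & b \in rem F l].
  have : uniq (rem F l) by apply: rem_uniq.
  have : size (rem F l) = 2 by rewrite size_rem ?sl.
  case: (rem F l) => [|a [|b []]] // _; rewrite /= inE andbT => ne.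
  by exists a, b; rewrite !inE !eqxx orbT.
move: al bl; rewrite !mem_rem_uniq // !inE => /andP[aF al] /andP[bF bl].
have [ta tb] := (PF_twin a al aF, PF_twin b bl bF).
have lea : a <= F by apply: (gap_le frobF); case/andP: ta.
have leb : b <= F by apply: (gap_le frobF); case/andP: tb.
have twinE x : x <= F -> ~~ S x -> ~~ S (F - x) -> x = a \/ x = b.
  move=> le gx gFx; have sub : {subset [:: a; b] <= filter (twin_gap S F) (iota 0 F.+1)}.
    by move=> y; rewrite !inE mem_filter mem_iota => /orP[]/eqP->; rewrite ?ta ?tb /= add0n ltnS.
  have uab : uniq [:: a; b] by rewrite /= inE neab.
  have szab : size (filter (twin_gap S F) (iota 0 F.+1)) <= size [:: a; b] by rewrite size_filter twin2.
  have [_ Eab] := uniq_min_size uab sub szab.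
  have : x \in [:: a; b] by rewrite Eab mem_filter mem_iota /twin_gap gx gFx /= ltnS.
  by rewrite !inE => /orP[]/eqP->; [left | right].
(* Reflection in [F] preserves the pair; it cannot fix both elements, as each would be half of
   [F]. *)
have ab : a + b = F.
  have sum_eq x y z : x != y -> x <= z -> y <= z ->
      (z - x = x \/ z - x = y) -> (z - y = x \/ z - y = y) -> x + y = z by clear; lia.
  case/andP: ta => ga gFa; case/andP: tb => gb gFb.
  by apply: sum_eq => //; apply: twinE; rewrite ?leq_subr ?subKn.
(* Half of an even [F] would be a twin gap fixed by reflection, forcing [a = b]. *)
have F_odd : odd F.
  apply/negPn/negP => Fe; have E2 : F = F./2 + F./2 by rewrite addnn halfK (negbTE Fe) subn0.
  have gh : ~~ S F./2 by apply: contra (proj1 frobF) => Sh; rewrite E2 Sadd.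
  have leh : F./2 <= F by rewrite [leqRHS]E2 leq_addr.
  have gFh : ~~ S (F - F./2) by rewrite {1}E2 addnK.
  have [Eh|Eh] := twinE _ leh gh gFh; move/eqP: neab; apply.
    by apply: (@addnI a); rewrite ab [RHS]E2 Eh.
  by apply: (@addIn b); rewrite ab [LHS]E2 Eh.
wlog ao : a b neab al aF bl bF ta tb twinE lea leb ab / odd a => [W|].
  have [ao|ae] := boolP (odd a); first exact: (W a b).
  apply: (W b a) => //; first by rewrite eq_sym.
  - by move=> x le gx gFx; have [->|->] := twinE x le gx gFx; [right | left].
  - by rewrite addnC.
  - by move: F_odd; rewrite -ab oddD (negbTE ae).
exists a, b; split.
  by split=> //; [move: F_odd; rewrite -ab oddD ao | apply/lP | apply/lP].
rewrite ab; split; [by case: frobF | by case: frobF | move=> x le].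
have [Sx|gx] := boolP (S x); first by left.
have [SFx|gFx] := boolP (S (F - x)); first by right; left.
by have [->|->] := twinE x le gx gFx; right; right; [left | right].
Qed.

Theorem theorem5p7 :
  (forall a1 a2 a3 a4 : nat,
      odd a1 -> odd a2 -> odd a3 -> odd a4 ->
      1 < a1 -> 1 < a2 -> 1 < a3 -> 1 < a4 ->
      gcd_seq (gens4 a1 a2 a3 a4) = 1 ->
      let S := in_gen (gens4 a1 a2 a3 a4) in
      numerical_semigroup S /\ embdim S 4 /\
      all odd (gens4 a1 a2 a3 a4) /\ (forall x, min_gen S x -> odd x) /\
      almost_symmetric S /\ sg_type S 3)
  /\
  (forall S : pred nat,
      numerical_semigroup S -> embdim S 4 -> almost_symmetric S ->
      sg_type S 3 -> (forall x, min_gen S x -> odd x) ->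
      exists a1 a2 a3 a4 : nat,
        [/\ odd a1, odd a2, odd a3 & odd a4] /\
        [/\ 1 < a1, 1 < a2, 1 < a3 & 1 < a4] /\
        forall x, S x = in_gen (gens4 a1 a2 a3 a4) x).
Proof.
split=> [a1 a2 a3 a4 o1 o2 o3 o4 h1 h2 h3 h4 gcd1 | S numS [l [ul [lP sl]]] asym type3 oddS].
  exact: gens4_almost_symmetric.
have [f [g [[fo ge [Sf pf] [Sg pg]] [Sfg cond dual]]]] := type3_duality numS asym type3.
have minl i : i < 4 -> min_gen S (nth 0 l i) by move=> lti; apply/lP/mem_nth; rewrite sl.
apply: (@odd_almost_symmetric_gens4 (nth 0 l) S f g) => //.
- exact: min_gen_comb.
- by move=> i /minl /oddS.
- move=> i j s lti ltj Ss E; have [_ [_ irr]] := minl i lti; have [nj0 [Snj _]] := minl j ltj.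
  (* A positive [s] would split a minimal generator; [s = 0] makes two entries of the duplicate-free
     [l] equal. *)
  have [s0|s_gt0] := posnP s; last by case: irr; exists (nth 0 l j), s.
  by apply/eqP; rewrite -(nth_uniq 0 _ _ ul) ?sl // E s0 addn0.
Qed.
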